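(* Let $\mathbf X=(\xi_{jk}X_{jk})_{1\le j\le N,\,1\le k\le n}$ be the sparse random matrix described in the context, with $\mathbb E X_{jk}=0$ and $\mathbb E|X_{jk}|^2=1$. Suppose that for some $\delta>0$ there is a constant $\mu_{4+\delta}>0$ such that $$\mathbb E|X_{jk}|^{4+\delta}\le \mu_{4+\delta}<\infty\quad\text{for all } j,k\ge 1.$$ Put $\varkappa=\frac{\delta}{2(4+\delta)}$ and suppose that there exists a constant $B>0$ such that $$Np\ge B\,(\log N)^{\frac{3}{2\varkappa}}.$$ Then for every $Q\ge 1$ and $A>0$ there exist constants $K$ and $C$, depending only on $Q,\delta,\mu_{4+\delta},A,B$, such that $$\Pr\{s_1\ge K\sqrt{Np}\}\le C N^{-Q}+N^2p\,\Pr\{|X_{11}|>A(Np)^{\frac12-\varkappa}\ln N\}.$$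
   Context: For integers $N>n\ge 1$, the $X_{jk}$ ($1\le j\le N$, $1\le k\le n$) are independent identically distributed real random variables with mean zero and $\mathbb E X_{jk}^2=1$; their common distribution may depend on $N$. They are independent of a family $\xi_{jk}$ ($1\le j\le N$, $1\le k\le n$) of independent Bernoulli ($\{0,1\}$-valued) random variables with $\mathbb E\xi_{jk}=p=p_N$. The matrix is $\mathbf X=(\xi_{jk}X_{jk})_{1\le j\le N,1\le k\le n}$, with singular values $s_1\ge\cdots\ge s_n$. Standing assumption: $n=n(N)$ and $n/N\to y_0\in(0,1)$ as $N\to\infty$; only the parameter $N$ is varied. Hypotheses are understood uniformly in $N$ and constants do not depend on $N$. *)

(* Defs.v *)
From HB Require Import structures.
From mathcomp Require Export all_boot all_order all_algebra.
From mathcomp Require Export all_classical all_reals all_analysis.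

Set Implicit Arguments.
Unset Strict Implicit.
Unset Printing Implicit Defensive.

Export Order.TTheory GRing.Theory Num.Theory.
Export numFieldNormedType.Exports.

Local Open Scope classical_set_scope.
Local Open Scope ring_scope.

Section SingularValues.
Context {R : realType} {N n : nat}.
Implicit Type M : 'M[R]_(N, n).

(* For n <= N, every singular value s_1 >= ... >= s_n of M is the nonnegative
   square root of an eigenvalue of the n x n matrix M^T M. *)
Definition singular_values M : set R :=
  [set s | 0 <= s /\ eigenvalue (M^T *m M) (s ^+ 2)].

(* The supremum of a finite set, attained by the spectral theorem as soon as
   0 < n. *)
Definition largest_singular_value M : R := sup (singular_values M).

End SingularValues.

Section RandomVariables.
Context {d : measure_display} {T : measurableType d} {R : realType}.
Variable P : probability T R.

Definition mutually_independent (I : finType) (Y : I -> {RV P >-> R}) : Prop :=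
  forall (J : {set I}) (B : I -> set R), (forall i, measurable (B i)) ->
    P (\bigcap_(i in [set` J]) (Y i @^-1` B i)) =
    (\prod_(i in J) P (Y i @^-1` B i))%E.

Definition identically_distributed (Y Z : {RV P >-> R}) : Prop :=
  forall B : set R, measurable B -> P (Y @^-1` B) = P (Z @^-1` B).

Section SparseMatrix.
Context {N n : nat}.
Variables X xi : 'I_N -> 'I_n -> {RV P >-> R}.

(* Independence of the concatenated family: the X_jk are independent, the
   xi_jk are independent, and the two families are independent of each
   other. *)
Definition entries (i : ('I_N * 'I_n) + ('I_N * 'I_n)) : {RV P >-> R} :=
  match i with
  | inl jk => X jk.1 jk.2
  | inr jk => xi jk.1 jk.2
  end.

Record sparse_model (p : R) : Prop := SparseModel {
  entries_independent : mutually_independent entries ;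
  X_identically_distributed :
    forall j k j' k', identically_distributed (X j k) (X j' k') ;
  X_mean0 : forall j k, ('E_P[X j k] = 0)%E ;
  X_second_moment : forall j k, ('E_P[(fun w => X j k w ^+ 2)%R] = 1)%E ;
  xi_01 : forall j k w, xi j k w = 0 \/ xi j k w = 1 ;
  xi_mean : forall j k, ('E_P[xi j k] = p%:E)%E
}.

Definition sparse_matrix (w : T) : 'M[R]_(N, n) :=
  \matrix_(j < N, k < n) (xi j k w * X j k w).

End SparseMatrix.
End RandomVariables.

Definition varkappa {R : realType} (delta : R) : R :=
  delta / (2 * (4 + delta)).

(* Main.v *)
Require Import Defs.
From mathcomp Require Import ring lra zify measurable_realfun.

Set Implicit Arguments.
Unset Strict Implicit.
Unset Printing Implicit Defensive.

Local Open Scope set_scope.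
Local Open Scope ring_scope.

(** Why the bound holds.  Write [x = N p], [l = ln N] and let
    [a = A x ^ (1 / 2 - varkappa) l] be the truncation level.  Some nonzero entry
    of the matrix exceeds [a] with probability at most
    [N ^ 2 p P(|X_11| > a)], the last term of the bound
    ([probability_large_entry]).  Otherwise the entries are bounded by [a], and
    the growth condition on [N p] says exactly that [a ^ 2] is at most a multiple
    of [x / l] ([truncation_level_le]).  For centered independent entries of
    variance at most [4 p] and of size at most [b], with [b ^ 2 = L x / l], the
    spectral norm is of order [sqrt x] up to a probability [N ^ (- Q)]; no
    logarithm is lost, and this is the substance of the proof.  Truncation
    shifts the mean of an entry, but by the moment of order [4 + delta] this
    adds only a matrix of norm [O(sqrt x)].

    The norm of the rescaled matrix [Z] is estimated by the trace of
    [(Z^T Z) ^ m], where [m] is a power of two of order [l].  The mean of this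
    trace is a sum over closed walks of length [2 m] in the complete bipartite
    graph on rows and columns, to which only the walks using each of their edges
    at least twice contribute.  Counting these walks directly with the required
    precision is delicate.  Instead, a walk with [v] vertices has weight at most
    [q ^ (v - 1)] with [q = 4 p / b ^ 2], and since [q N <= m] the [N] rows and [n]
    columns can be replaced by [2 m] rows and [2 m] columns carrying no weight
    ([alphabet_reduction], [mean_tr_gram_le]).  This is the dimension reduction
    of Bandeira and van Handel.

    What remains is the number of such walks for a [2 m] by [2 m] matrix.  It is
    at most the mean of [tr ((H^T H) ^ m)] for a matrix [H] with independent
    centered two-valued entries, all of whose higher moments are at least [1]
    ([covered_walks_le]).  As the size of [H] is of the order of [m], a net of
    the unit ball with [exp(O(m))] points and the Gaussian tails of the bilinear
    forms of [H] suffice to bound this mean by [(C m) ^ m]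
    ([covered_walks_bound]).  Markov's inequality then concludes
    ([tr_gram_tail], [sparse_tail]).

    To keep these averages finite sums, the truncated entries are rounded to a
    finite grid, which changes the matrix by [O(sqrt x)] in norm.  The event in
    the theorem is measurable because the existence of a large eigenvalue can be
    expressed by countably many conditions on the characteristic polynomial
    ([measurable_le_largest_singular_value]). *)

(** * Euclidean norms, singular values and traces *)

Section EuclideanBounds.
Variable R : realType.
Implicit Types n N m : nat.

Lemma cauchy_schwarz_sum (I : finType) (a b : I -> R) :
  (\sum_i a i * b i) ^+ 2 <= (\sum_i a i ^+ 2) * (\sum_i b i ^+ 2).
Proof.
have : 0 <= \sum_i \sum_j (a i * b j - a j * b i) ^+ 2.
  by apply: sumr_ge0 => i _; apply: sumr_ge0 => j _; exact: sqr_ge0.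
have -> : \sum_i \sum_j (a i * b j - a j * b i) ^+ 2 =
    2 * ((\sum_i a i ^+ 2) * (\sum_i b i ^+ 2) - (\sum_i a i * b i) ^+ 2).
  transitivity (\sum_i \sum_j (a i ^+ 2 * b j ^+ 2 +
      (b i ^+ 2 * a j ^+ 2 - 2 * ((a i * b i) * (a j * b j))))).
    by apply: eq_bigr => i _; apply: eq_bigr => j _; ring.
  under eq_bigr do rewrite !big_split/= sumrN -!mulr_sumr.
  by rewrite !big_split/= sumrN -!mulr_suml -!mulr_sumr -!mulr_suml; ring.
by rewrite pmulr_rge0 ?ltr0n// subr_ge0.
Qed.

Definition dot n (u v : 'rV[R]_n) : R := (u *m v^T) 0 0.

Lemma dotE n (u v : 'rV[R]_n) : dot u v = \sum_i u 0 i * v 0 i.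
Proof. by rewrite /dot mxE; apply: eq_bigr => i _; rewrite mxE. Qed.

Lemma dotC n (u v : 'rV[R]_n) : dot u v = dot v u.
Proof. by rewrite !dotE; apply: eq_bigr => i _; rewrite mulrC. Qed.

Lemma dotDl n (u v w : 'rV[R]_n) : dot (u + v) w = dot u w + dot v w.
Proof. by rewrite /dot mulmxDl mxE. Qed.

Lemma dotDr n (u v w : 'rV[R]_n) : dot w (u + v) = dot w u + dot w v.
Proof. by rewrite dotC dotDl dotC (dotC v). Qed.

Lemma dotZl n a (u v : 'rV[R]_n) : dot (a *: u) v = a * dot u v.
Proof. by rewrite /dot -scalemxAl mxE. Qed.

Lemma dotZr n a (u v : 'rV[R]_n) : dot u (a *: v) = a * dot u v.
Proof. by rewrite dotC dotZl dotC. Qed.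

Lemma dotNl n (u v : 'rV[R]_n) : dot (- u) v = - dot u v.
Proof. by rewrite /dot mulNmx mxE. Qed.

Lemma dotNr n (u v : 'rV[R]_n) : dot u (- v) = - dot u v.
Proof. by rewrite dotC dotNl dotC. Qed.

Lemma dot_mulmxr n m (u : 'rV[R]_n) (v : 'rV[R]_m) A :
  dot (u *m A) v = dot u (v *m A^T).
Proof. by rewrite /dot trmx_mul trmxK mulmxA. Qed.

Lemma dotvv n (u : 'rV[R]_n) : dot u u = \sum_i u 0 i ^+ 2.
Proof. by rewrite dotE; apply: eq_bigr => i _; rewrite expr2. Qed.

Lemma dot_ge0 n (u : 'rV[R]_n) : 0 <= dot u u.
Proof. by rewrite dotvv; apply: sumr_ge0 => i _; exact: sqr_ge0. Qed.

Lemma dot_gt0 n (u : 'rV[R]_n) : u != 0 -> 0 < dot u u.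
Proof.
move=> u0; rewrite lt_neqAle dot_ge0 andbT eq_sym; apply: contraNN u0.
rewrite dotvv psumr_eq0; last by move=> i _; exact: sqr_ge0.
move=> /allP u0; apply/eqP/rowP => i; rewrite mxE.
by apply/eqP; rewrite -sqrf_eq0; apply: u0; rewrite mem_index_enum.
Qed.

Definition enorm n (u : 'rV[R]_n) : R := Num.sqrt (dot u u).

Lemma enorm_ge0 n (u : 'rV[R]_n) : 0 <= enorm u.
Proof. exact: sqrtr_ge0. Qed.

Lemma enorm2 n (u : 'rV[R]_n) : enorm u ^+ 2 = dot u u.
Proof. by rewrite sqr_sqrtr// dot_ge0. Qed.

Lemma enormZ n a (u : 'rV[R]_n) : enorm (a *: u) = `|a| * enorm u.
Proof.
by rewrite /enorm dotZl dotZr mulrA -expr2 sqrtrM ?sqr_ge0// sqrtr_sqr.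
Qed.

Lemma cauchy_schwarz n (u v : 'rV[R]_n) : `|dot u v| <= enorm u * enorm v.
Proof.
rewrite -(@ler_pXn2r _ 2)// ?nnegrE ?mulr_ge0 ?enorm_ge0//.
rewrite -normrX ger0_norm ?sqr_ge0// exprMn !enorm2 !dotvv dotE.
exact: cauchy_schwarz_sum.
Qed.

Lemma ler_enormD n (u v : 'rV[R]_n) : enorm (u + v) <= enorm u + enorm v.
Proof.
rewrite -(@ler_pXn2r _ 2)// ?nnegrE ?addr_ge0 ?enorm_ge0//.
rewrite sqrrD !enorm2 dotDl !dotDr (dotC v u).
have := cauchy_schwarz u v; rewrite ler_norml => /andP[_ h].
by rewrite mulr2n; lra.
Qed.

(** Cauchy-Schwarz gives [(v W v^T)^2 <= v W^2 v^T] for a unit vector [v];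
    applying this to [W], [W^2], [W^4] and so on avoids diagonalizing [W]. *)
Lemma quadratic_form_pow n (W : 'M[R]_n) (v : 'rV[R]_n) i :
  W^T = W -> dot v v = 1 ->
  dot (v *m W) v ^+ (2 ^ i) <= dot (v *m W ^+ (2 ^ i)) v.
Proof.
move=> + v1; elim: i W => [|i IH] W Wsym; first by rewrite !expr1.
rewrite expnS !exprM.
have W2sym : (W ^+ 2)^T = W ^+ 2 by rewrite expr2 trmx_mul Wsym.
apply: le_trans (IH _ W2sym).
apply: lerXn2r; rewrite ?nnegrE ?sqr_ge0//.
  by rewrite expr2 mulmxA dot_mulmxr Wsym dot_ge0.
rewrite expr2 mulmxA (dot_mulmxr (v *m W)) Wsym -enorm2.
have cs : `|dot (v *m W) v| <= enorm (v *m W).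
  by apply: le_trans (cauchy_schwarz _ _) _; rewrite {2}/enorm v1 sqrtr1 mulr1.
by rewrite -expr2 -(@real_normK _ (dot _ _)) ?num_real// lerXn2r// nnegrE enorm_ge0.
Qed.

Lemma dot_mulmx_le_tr n m (S : 'M[R]_(n, m)) (v : 'rV[R]_n) :
  dot v v = 1 -> dot (v *m S) (v *m S) <= \tr (S *m S^T).
Proof.
move=> v1; rewrite dotvv mxtrace_mulC.
have -> : \tr (S^T *m S) = \sum_k \sum_i S i k ^+ 2.
  by apply: eq_bigr => k _; rewrite mxE; apply: eq_bigr => i _; rewrite mxE expr2.
apply: ler_sum => k _; rewrite mxE.
by apply: le_trans (cauchy_schwarz_sum _ _) _; rewrite -dotvv v1 mul1r.
Qed.

Lemma trmx_gram N n (Z : 'M[R]_(N, n)) : (Z^T *m Z)^T = Z^T *m Z.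
Proof. by rewrite trmx_mul trmxK. Qed.

Lemma trmx_exp n (W : 'M[R]_n) k : W^T = W -> (W ^+ k)^T = W ^+ k.
Proof.
move=> Wsym; elim: k => [|k IH]; first by rewrite expr0 trmx1.
by rewrite {1}exprS trmx_mul IH Wsym exprSr.
Qed.

(** The power [W ^ (2 ^ i.+1)] is the square of the symmetric matrix
    [S = W ^ (2 ^ i)], so its quadratic form at [v] is [|v S| ^ 2], at most the
    squared Frobenius norm of [S], which is the trace. *)
Lemma gram_pow_le_tr N n (Z : 'M[R]_(N, n)) (v : 'rV[R]_n) i :
  dot v v = 1 ->
  dot (v *m Z^T) (v *m Z^T) ^+ (2 ^ i.+1) <= \tr ((Z^T *m Z) ^+ (2 ^ i.+1)).
Proof.
move=> v1; set W := Z^T *m Z.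
have Wsym : W^T = W := trmx_gram Z.
rewrite (dot_mulmxr v) trmxK -mulmxA dotC.
apply: le_trans (quadratic_form_pow i.+1 Wsym v1) _.
have Ssym := trmx_exp (2 ^ i) Wsym.
rewrite expnS mul2n -addnn exprD mulmxA dot_mulmxr Ssym.
by apply: le_trans (dot_mulmx_le_tr _ v1) _; rewrite Ssym.
Qed.

Lemma gram_pow_tr_ge0 N n (Z : 'M[R]_(N, n)) i :
  0 <= \tr ((Z^T *m Z) ^+ (2 ^ i.+1)).
Proof.
have Ssym := trmx_exp (2 ^ i) (trmx_gram Z).
rewrite expnS mul2n -addnn exprD -{2}Ssym /mxtrace.
apply: sumr_ge0 => k _; rewrite mxE; apply: sumr_ge0 => l _.
by rewrite mxE -expr2 sqr_ge0.
Qed.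

Lemma singular_value_vector N n (M : 'M[R]_(N, n)) s :
  singular_values M s ->
  exists2 v : 'rV[R]_n, dot v v = 1 & enorm (v *m M^T) = s.
Proof.
move=> [s0 /eigenvalueP[v vM v0]].
have nv : 0 < enorm v by rewrite sqrtr_gt0 dot_gt0.
have d1 : dot ((enorm v)^-1 *: v) ((enorm v)^-1 *: v) = 1.
  by rewrite dotZl dotZr mulrA -invfM -expr2 -enorm2 mulVf// expf_neq0// gt_eqF.
exists ((enorm v)^-1 *: v) => //.
rewrite /enorm dot_mulmxr trmxK -mulmxA -scalemxAl vM.
rewrite scalerA mulrC -scalerA dotZr d1 mulr1.
by rewrite sqrtr_sqr ger0_norm.
Qed.

Lemma enorm_mulmx_le_entries N n (D : 'M[R]_(N, n)) (v : 'rV[R]_n) (e : R) :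
  0 <= e -> (n <= N)%N -> (forall j k, `|D j k| <= e) -> dot v v = 1 ->
  enorm (v *m D^T) <= N%:R * e.
Proof.
move=> e0 nN De v1; rewrite -(@ler_pXn2r _ 2)// ?nnegrE ?enorm_ge0 ?mulr_ge0//.
rewrite enorm2; apply: le_trans (dot_mulmx_le_tr _ v1) _.
rewrite trmxK mxtrace_mulC.
have -> : \tr (D *m D^T) = \sum_j \sum_k D j k ^+ 2.
  by apply: eq_bigr => k _; rewrite mxE; apply: eq_bigr => i _; rewrite mxE expr2.
apply: (@le_trans _ _ (\sum_(j < N) \sum_(k < n) e ^+ 2)).
  apply: ler_sum => j _; apply: ler_sum => k _.
  by rewrite -real_normK ?num_real// lerXn2r// nnegrE.
rewrite !sumr_const !card_ord -mulrnA -[leLHS]mulr_natl mulnC.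
rewrite exprMn; apply: ler_wpM2r; first exact: sqr_ge0.
by rewrite -natrX ler_nat expnS expn1 leq_mul2l nN orbT.
Qed.

(** A unit singular vector [v] satisfies [s = |v (b Z + E)^T|], which is at most
    [b |v Z^T| + |v E^T|]; the trace bounds the first term, the Frobenius norm
    of [E] the second. *)
Lemma singular_value_le N n (Z E : 'M[R]_(N, n)) (b tau e s : R) i :
  (n <= N)%N -> 0 <= b -> 0 <= e -> 0 <= tau ->
  (forall j k, `|E j k| <= e) ->
  \tr ((Z^T *m Z) ^+ (2 ^ i.+1)) <= tau ^+ (2 * 2 ^ i.+1) ->
  singular_values (b *: Z + E) s -> s <= b * tau + N%:R * e.
Proof.
move=> nN b0 e0 tau0 Ee trZ /singular_value_vector[v v1 <-].
rewrite linearD/= linearZ/= mulmxDr -scalemxAr.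
apply: le_trans (ler_enormD _ _) _; apply: lerD; last first.
  exact: enorm_mulmx_le_entries.
rewrite enormZ ger0_norm// ler_wpM2l//.
rewrite -(@ler_pXn2r _ (2 * 2 ^ i.+1)) ?nnegrE ?enorm_ge0 ?muln_gt0 ?expn_gt0//.
rewrite exprM enorm2; apply: le_trans trZ.
exact: gram_pow_le_tr.
Qed.

(** Each diagonal entry of [(H^T H) ^ m] is a quadratic form evaluated at a basis
    vector. *)
Lemma tr_gram_pow_le r (H : 'M[R]_r) (s : R) m :
  0 <= s ->
  (forall u v : 'rV[R]_r, dot (u *m H) v <= s * (enorm u * enorm v)) ->
  \tr ((H^T *m H) ^+ m) <= r%:R * s ^+ (2 * m).
Proof.
move=> s0 Hs.
have HsR u : enorm (u *m H) <= s * enorm u.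
  have [->|] := eqVneq (enorm (u *m H)) 0; first by rewrite mulr_ge0 ?enorm_ge0.
  move=> uH0; have uHp : 0 < enorm (u *m H) by rewrite lt_neqAle eq_sym uH0 enorm_ge0.
  rewrite -(ler_pM2r uHp) -expr2 enorm2 -mulrA; exact: Hs.
have HsL v : enorm (v *m H^T) <= s * enorm v.
  have [->|] := eqVneq (enorm (v *m H^T)) 0; first by rewrite mulr_ge0 ?enorm_ge0.
  move=> uH0; have uHp : 0 < enorm (v *m H^T) by rewrite lt_neqAle eq_sym uH0 enorm_ge0.
  rewrite -(ler_pM2r uHp) -expr2 enorm2 dot_mulmxr trmxK -mulrA mulrC dotC.
  by rewrite (mulrC _ s) (mulrC (enorm v)); exact: Hs.
have pw (u : 'rV[R]_r) k : enorm (u *m (H^T *m H) ^+ k) <= s ^+ (2 * k) * enorm u.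
  elim: k u => [|k IH] u; first by rewrite expr0 mulmx1 mul1r.
  rewrite exprS mulmxA; apply: le_trans (IH _) _.
  rewrite mulnS addnC exprD -mulrA ler_wpM2l ?exprn_ge0// mulmxA.
  apply: le_trans (HsR _) _; rewrite expr2 -mulrA ler_wpM2l//.
rewrite /mxtrace.
have -> : r%:R * s ^+ (2 * m) = \sum_(i < r) s ^+ (2 * m).
  by rewrite sumr_const card_ord mulr_natl.
apply: ler_sum => i _.
pose e : 'rV[R]_r := delta_mx 0 i.
have e1 : dot e e = 1.
  rewrite dotvv (bigD1 i)//= big1; first by rewrite mxE !eqxx expr1n addr0.
  by move=> j ji; rewrite mxE (negbTE ji) andbF expr0n.
have -> : ((H^T *m H) ^+ m) i i = dot (e *m (H^T *m H) ^+ m) e.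
  rewrite dotE (bigD1 i)//= big1 ?addr0; last first.
    by move=> j ji; rewrite [e 0 j]mxE (negbTE ji) andbF mulr0.
  by rewrite [e 0 i]mxE !eqxx mulr1 -rowE mxE.
apply: le_trans (ler_norm _) _; apply: le_trans (cauchy_schwarz _ _) _.
have -> : enorm e = 1 by rewrite /enorm e1 sqrtr1.
by rewrite mulr1; apply: le_trans (pw _ _) _; rewrite /enorm e1 sqrtr1 mulr1.
Qed.

End EuclideanBounds.

(** * Traces as sums over closed walks *)

Section TracesAsWalks.
Variable R : realType.

Definition fcons m (T : finType) (x : T) (f : {ffun 'I_m -> T}) :
    {ffun 'I_m.+1 -> T} :=
  [ffun i => oapp f x (unlift ord0 i)].

Definition fsnoc m (T : finType) (f : {ffun 'I_m -> T}) (y : T) (i : 'I_m.+1) : T :=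
  oapp f y (insub (val i)).

Lemma fcons0 m (T : finType) (x : T) (f : {ffun 'I_m -> T}) : fcons x f ord0 = x.
Proof. by rewrite ffunE unlift_none. Qed.

Lemma fconsS m (T : finType) (x : T) (f : {ffun 'I_m -> T}) i :
  fcons x f (lift ord0 i) = f i.
Proof. by rewrite ffunE liftK. Qed.

Lemma sum_ffun_recl m (T : finType) (F : {ffun 'I_m.+1 -> T} -> R) :
  \sum_f F f = \sum_x \sum_(g : {ffun 'I_m -> T}) F (fcons x g).
Proof.
rewrite pair_big/= (reindex (fun p : T * {ffun 'I_m -> T} => fcons p.1 p.2))//=.
exists (fun f => (f ord0, [ffun i => f (lift ord0 i)])) => [[x g] _|f _] /=.
  by rewrite fcons0; congr pair; apply/ffunP => i; rewrite ffunE fconsS.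
apply/ffunP => i; rewrite ffunE.
by case: unliftP => [k ->|->]//=; rewrite ffunE.
Qed.

Lemma fsnoc_cons0 m (T : finType) (f : {ffun 'I_m -> T}) z y :
  fsnoc (fcons z f) y ord0 = z.
Proof. by rewrite /fsnoc insubT/= -[RHS](fcons0 z f); congr (fcons _ _ _); exact: val_inj. Qed.

Lemma fsnoc_consS m (T : finType) (f : {ffun 'I_m -> T}) z y i :
  fsnoc (fcons z f) y (lift ord0 i) = fsnoc f y i.
Proof.
rewrite /fsnoc /= /bump/= add1n; case: (ltnP i m) => im.
  rewrite !insubT/= -(fconsS z f); congr (fcons _ _ _); exact: val_inj.
by rewrite !insubF//= ltnNge ?ltnS im.
Qed.

Lemma mx_exp_walks n (W : 'M[R]_n) m x y :
  (W ^+ m.+1) x y =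
  \sum_(f : {ffun 'I_m -> 'I_n}) \prod_(a < m.+1) W (fcons x f a) (fsnoc f y a).
Proof.
elim: m x => [|m IH] x.
  rewrite expr1 (eq_bigr (fun=> W x y)) => [|f _]; last first.
    by rewrite big_ord1 fcons0 /fsnoc insubF.
  by rewrite sumr_const card_ffun !card_ord.
rewrite exprS mxE sum_ffun_recl; apply: eq_bigr => z _.
rewrite IH mulr_sumr; apply: eq_bigr => f _.
rewrite [RHS]big_ord_recl fcons0 fsnoc_cons0; congr (_ * _).
by apply: eq_bigr => a _; rewrite fconsS fsnoc_consS.
Qed.

Lemma fsnoc_ordS m (T : finType) (f : {ffun 'I_m -> T}) x i :
  fsnoc f x i = fcons x f (ordS i).
Proof.
rewrite /fsnoc; case: (ltnP i m) => im.
  rewrite insubT/= -(fconsS x f); congr (fcons _ _ _).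
  by apply: val_inj; rewrite /= /bump/= add1n modn_small.
rewrite insubF ?ltnNge ?im//= -[LHS](fcons0 x f); congr (fcons _ _ _).
apply: val_inj => /=.
have -> : val i = m by apply/eqP; rewrite eqn_leq im -ltnS ltn_ord.
by rewrite modnn.
Qed.

Lemma tr_exp_walks n (W : 'M[R]_n) m :
  \tr (W ^+ m.+1) =
  \sum_(k : {ffun 'I_m.+1 -> 'I_n}) \prod_(a < m.+1) W (k a) (k (ordS a)).
Proof.
rewrite sum_ffun_recl; apply: eq_bigr => x _; rewrite mx_exp_walks.
apply: eq_bigr => f _; apply: eq_bigr => a _.
by rewrite fsnoc_ordS.
Qed.

(** The [2 m] edges of the closed walk [k_0 j_0 k_1 j_1 ... k_0] in the complete
    bipartite graph between rows and columns: at time [a] the walk runs along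
    the edge from [k_a] to [j_a], then along the one from [j_a] to [k_(a+1)]. *)
Definition walk_edge m (I K : finType) (j : {ffun 'I_m -> I}) (k : {ffun 'I_m -> K})
  (t : 'I_m * bool) : I * K := (j t.1, k (if t.2 then ordS t.1 else t.1)).

Lemma tr_gram_walks N n (Z : 'M[R]_(N, n)) m :
  \tr ((Z^T *m Z) ^+ m.+1) =
  \sum_(j : {ffun 'I_m.+1 -> 'I_N}) \sum_(k : {ffun 'I_m.+1 -> 'I_n})
    \prod_t Z (walk_edge j k t).1 (walk_edge j k t).2.
Proof.
rewrite tr_exp_walks exchange_big/=; apply: eq_bigr => k _.
transitivity (\prod_(a < m.+1) \sum_i (Z i (k a) * Z i (k (ordS a)))).
  by apply: eq_bigr => a _; rewrite mxE; apply: eq_bigr => i _; rewrite mxE.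
rewrite bigA_distr_bigA/=; apply: eq_bigr => j _.
rewrite -(pair_bigA _ (fun a b => Z (walk_edge j k (a, b)).1 (walk_edge j k (a, b)).2))/=.
by apply: eq_bigr => a _; rewrite big_bool/= mulrC.
Qed.

End TracesAsWalks.

Section EdgesAndVertices.
Variables (I K : finType) (f : nat -> I) (g : nat -> K).

Fixpoint rows_upto b : {set I} :=
  if b is b'.+1 then f b |: rows_upto b' else [set f 0%N].

Fixpoint cols_upto b : {set K} :=
  if b is b'.+1 then g b |: cols_upto b' else [set g 0%N].

Fixpoint edges_upto b : {set I * K} :=
  if b is b'.+1 then (f b, g b) |: ((f b', g b) |: edges_upto b')
  else [set (f 0%N, g 0%N)].

Lemma mem_rows_upto a b : (a <= b)%N -> f a \in rows_upto b.
Proof.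
elim: b => [|b IH]; first by rewrite leqn0 => /eqP->; rewrite inE.
rewrite leq_eqVlt => /predU1P[->|ab]; first by rewrite !inE eqxx.
by rewrite !inE IH ?orbT.
Qed.

Lemma mem_cols_upto a b : (a <= b)%N -> g a \in cols_upto b.
Proof.
elim: b => [|b IH]; first by rewrite leqn0 => /eqP->; rewrite inE.
rewrite leq_eqVlt => /predU1P[->|ab]; first by rewrite !inE eqxx.
by rewrite !inE IH ?orbT.
Qed.

Lemma edges_upto_sub b e :
  e \in edges_upto b -> (e.1 \in rows_upto b) && (e.2 \in cols_upto b).
Proof.
elim: b => [|b IH]/=; first by rewrite !inE => /eqP->/=; rewrite !eqxx.
rewrite !inE => /or3P[/eqP->|/eqP->|/IH/andP[-> ->]]/=; rewrite ?eqxx ?orbT//.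
by rewrite mem_rows_upto ?orbT.
Qed.

(** Every vertex after the first is entered through an edge not used before. *)
Lemma walk_vertices_edges b :
  (#|rows_upto b| + #|cols_upto b| <= (#|edges_upto b|).+1)%N.
Proof.
elim: b => [|b IH] /=; first by rewrite !cards1.
rewrite !cardsU1.
have newcol : (g b.+1 \notin cols_upto b) ==> ((f b, g b.+1) \notin edges_upto b).
  by apply/implyP; apply: contraNN => /edges_upto_sub/andP[].
have newrow : (f b.+1 \notin rows_upto b) ==>
    ((f b.+1, g b.+1) \notin (f b, g b.+1) |: edges_upto b).
  apply/implyP; apply: contraNN; rewrite !inE => /predU1P[[->]|].
    by rewrite mem_rows_upto.
  by move=> /edges_upto_sub/andP[].
move: newrow newcol IH.
case: (f b.+1 \notin _); case: (g b.+1 \notin _); case: (_ \notin _ |: _);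
  case: (_ \notin _) => //= _ _; lia.
Qed.

End EdgesAndVertices.

Lemma walk_edge_card m (I K : finType) (j : {ffun 'I_m.+1 -> I})
    (k : {ffun 'I_m.+1 -> K}) :
  (#|j @: [set: 'I_m.+1]| + #|k @: [set: 'I_m.+1]|
     <= (#|walk_edge j k @: [set: 'I_m.+1 * bool]|).+1)%N.
Proof.
pose f a := j (inord a); pose g a := k (inord a).
apply: (@leq_trans (#|rows_upto f m| + #|cols_upto g m|)).
  apply: leq_add; apply: subset_leq_card; apply/fintype.subsetP => x /imsetP[a _ ->].
    by rewrite -[a]inord_val mem_rows_upto// -ltnS.
  by rewrite -[a]inord_val mem_cols_upto// -ltnS.
apply: leq_trans (walk_vertices_edges f g m) _; rewrite ltnS.
have sub b : (b <= m)%N -> edges_upto f g b \subset walk_edge j k @: [set: _].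
  elim: b => [_|b IH bm]/=.
    apply/fintype.subsetP => e; rewrite inE => /eqP->.
    by apply/imsetP; exists (inord 0, false).
  rewrite !finset.subUset !finset.sub1set IH 1?ltnW// andbT; apply/andP; split.
    by apply/imsetP; exists (inord b.+1, false).
  apply/imsetP; exists (inord b, true) => //; congr (_, k _).
  have bm1 : (b < m.+1)%N by rewrite ltnS ltnW.
  by apply: val_inj => /=; rewrite !inordK ?modn_small ?ltnS.
by apply: subset_leq_card; exact: sub.
Qed.

Section IndependentFamilies.
Variable R : realType.
Variables (E V : finType) (w : E -> V -> R).
Hypothesis w_ge0 : forall e v, 0 <= w e v.
Hypothesis w_sum1 : forall e, \sum_v w e v = 1.

Definition product_law (c : {ffun E -> V}) : R := \prod_e w e (c e).

Definition product_mean (F : {ffun E -> V} -> R) : R :=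
  \sum_c product_law c * F c.

Lemma product_law_ge0 c : 0 <= product_law c.
Proof. exact: prodr_ge0. Qed.

Lemma product_mean_prod (g : E -> V -> R) :
  product_mean (fun c => \prod_e g e (c e)) = \prod_e \sum_v w e v * g e v.
Proof.
rewrite bigA_distr_bigA/=; apply: eq_bigr => c _.
by rewrite -big_split.
Qed.

Lemma le_product_mean F G : (forall c, F c <= G c) -> product_mean F <= product_mean G.
Proof.
by move=> FG; apply: ler_sum => c _; rewrite ler_wpM2l// product_law_ge0.
Qed.

Lemma product_mean_sum (J : finType) (F : J -> {ffun E -> V} -> R) :
  product_mean (fun c => \sum_j F j c) = \sum_j product_mean (F j).
Proof.
rewrite /product_mean exchange_big/=; apply: eq_bigr => c _.
by rewrite mulr_sumr.
Qed.

Lemma product_mean_markov F t : 0 < t -> (forall c, 0 <= F c) ->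
  \sum_(c | t <= F c) product_law c <= t^-1 * product_mean F.
Proof.
move=> t0 F0; rewrite mulr_sumr big_mkcond/=; apply: ler_sum => c _.
case: ifPn => [tF|_]; last first.
  by rewrite !mulr_ge0 ?invr_ge0 ?product_law_ge0// ltW.
rewrite mulrCA ler_peMr ?product_law_ge0//.
by rewrite mulrC ler_pdivlMr// mul1r.
Qed.

Variable val : E -> V -> R.

Definition moment e k : R := \sum_v w e v * val e v ^+ k.

Definition multiplicity (T : finType) (f : T -> E) e := #|[set t | f t == e]|.

Lemma product_mean_walk (T : finType) (f : T -> E) :
  product_mean (fun c => \prod_t val (f t) (c (f t))) =
  \prod_e moment e (multiplicity f e).
Proof.
rewrite -product_mean_prod; apply: eq_bigr => c _; congr (_ * _).
rewrite (partition_big f predT)//=; apply: eq_bigr => e _.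
rewrite (eq_bigr (fun=> val e (c e))) => [|t /eqP->//].
by rewrite prodr_const /multiplicity cardsE.
Qed.

(** For a centered independent family, the mean of the product along [f] vanishes
    unless [f] takes each of its values at least twice. *)
Definition covered_twice (T : finType) (f : T -> E) : bool :=
  [forall t, exists t', (t' != t) && (f t' == f t)].

Lemma covered_twiceP (T : finType) (f : T -> E) :
  reflect (forall e, multiplicity f e != 1%N) (covered_twice f).
Proof.
apply: (iffP forallP) => [cov e|mult t].
  apply/negP => /cards1P[t ft].
  have : t \in [set t | f t == e] by rewrite ft inE.
  rewrite inE => /eqP te.
  have /existsP[t' /andP[t't /eqP ft']] := cov t.
  have : t' \in [set t | f t == e] by rewrite inE ft' te.
  by rewrite ft inE (negbTE t't).
apply/existsP; apply: contrapT => no.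
have /negP := mult (f t); apply; apply/cards1P; exists t.
apply/setP => t'; rewrite !inE; apply/idP/eqP => [ft|->//].
apply/eqP; apply: contrapT => /negP t't; apply: no; exists t'.
by rewrite t't.
Qed.

Hypothesis mean0 : forall e, moment e 1 = 0.

Lemma moment0 e : moment e 0 = 1.
Proof. by rewrite /moment; under eq_bigr do rewrite mulr1. Qed.

Lemma walk_moment_eq0 (T : finType) (f : T -> E) :
  ~~ covered_twice f -> \prod_e moment e (multiplicity f e) = 0.
Proof.
move=> nc; have [e /negP] : exists e, ~ (multiplicity f e != 1%N).
  by apply/existsNP => h; move/negP: nc; apply; apply/covered_twiceP.
by rewrite negbK => /eqP me; rewrite (bigD1 e)//= me mean0 mul0r.
Qed.

Lemma walk_moment_le (T : finType) (f : T -> E) (q : R) :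
  (forall e k, (2 <= k)%N -> `|moment e k| <= q) ->
  \prod_e moment e (multiplicity f e) <=
    (covered_twice f)%:R * q ^+ #|f @: [set: T]|.
Proof.
move=> mq; case: (boolP (covered_twice f)) => [/covered_twiceP cov|/walk_moment_eq0->];
  last by rewrite mul0r.
rewrite mul1r; apply: le_trans (ler_norm _) _; rewrite normr_prod.
rewrite -prodr_const [leRHS]big_mkcond/=; apply: ler_prod => e _.
rewrite normr_ge0/=; case: ifPn => [/imsetP[t _ ->]|fe].
  apply: mq; rewrite ltn_neqAle eq_sym cov/=.
  by apply/card_gt0P; exists t; rewrite inE.
have -> : multiplicity f e = 0%N.
  apply/eqP; rewrite cards_eq0; apply/eqP/setP => t; rewrite !inE.
  by apply: contraNF fe => /eqP <-; exact: imset_f.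
by rewrite moment0 normr1.
Qed.

Lemma walk_moment_ge (T : finType) (f : T -> E) :
  (forall e k, (2 <= k)%N -> 1 <= moment e k) ->
  (covered_twice f)%:R <= \prod_e moment e (multiplicity f e).
Proof.
move=> mq; case: (boolP (covered_twice f)) => [/covered_twiceP cov|/walk_moment_eq0->]//.
apply: (@le_trans _ _ (\prod_(e : E) 1)); first by rewrite big1_eq.
apply: ler_prod => e _; rewrite ler01/=.
case: (multiplicity f e) (cov e) => [|[|k]]// _; first by rewrite moment0.
exact: mq.
Qed.

End IndependentFamilies.

(** * Reducing the number of rows and columns *)

Section SameKernel.
Variable T : finType.

Definition same_kernel (I J : finType) (j : {ffun T -> I}) (j' : {ffun T -> J}) :=
  [forall a, forall b, (j a == j b) == (j' a == j' b)].

Lemma same_kernelP (I J : finType) (j : {ffun T -> I}) (j' : {ffun T -> J}) :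
  reflect (forall a b, (j a == j b) = (j' a == j' b)) (same_kernel j j').
Proof.
apply: (iffP forallP) => [h a b|h a]; first by have /forallP/(_ b)/eqP := h a.
by apply/forallP => b; rewrite h.
Qed.

Lemma same_kernelC (I J : finType) (j : {ffun T -> I}) (j' : {ffun T -> J}) :
  same_kernel j j' = same_kernel j' j.
Proof. by apply/same_kernelP/same_kernelP => h a b; rewrite h. Qed.

Section Extension.
Variables (I J : finType) (j : {ffun T -> I}).

Let S := {x : I | x \in j @: [set: T]}.

Lemma imset_point_subproof t : j t \in j @: [set: T].
Proof. exact: imset_f. Qed.

Let pt t : S := exist _ (j t) (imset_point_subproof t).

Let rep (x : S) : T := sval (cid2 (imsetP (valP x))).

Let repK x : j (rep x) = val x.
Proof. by rewrite /rep; case: cid2 => t /= _ ->. Qed.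

Let ext (phi : {ffun S -> J}) : {ffun T -> J} := [ffun t => phi (pt t)].

Let card_S : #|{: S}| = #|j @: [set: T]|.
Proof. by rewrite card_sig; apply: eq_card => x; rewrite !inE. Qed.

Let same_kernel_ext (j' : {ffun T -> J}) : same_kernel j j' ->
  j' = ext [ffun x => j' (rep x)].
Proof.
move=> /same_kernelP h; apply/ffunP => t; rewrite !ffunE.
by apply/eqP; rewrite -h repK.
Qed.

Lemma card_same_kernel_le :
  (#|[set j' : {ffun T -> J} | same_kernel j j']| <= #|J| ^ #|j @: [set: T]|)%N.
Proof.
rewrite -card_S -card_ffun -cardsT.
apply: leq_trans (leq_imset_card ext _); apply: subset_leq_card.
apply/fintype.subsetP => j'; rewrite inE => /same_kernel_ext ->.
exact: imset_f.
Qed.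

Lemma card_same_kernel_ge :
  (#|J| ^_ #|j @: [set: T]| <= #|[set j' : {ffun T -> J} | same_kernel j j']|)%N.
Proof.
rewrite -card_S -card_inj_ffuns -cardsE.
have ext_inj : injective ext.
  move=> phi psi /ffunP e; apply/ffunP => x.
  have <- : pt (rep x) = x by apply: val_inj; rewrite /= repK.
  by have := e (rep x); rewrite !ffunE.
rewrite -(card_imset _ ext_inj); apply: subset_leq_card.
apply/fintype.subsetP => _ /imsetP[phi + ->]; rewrite !inE => /fintype.injectiveP phi_inj.
apply/same_kernelP => a b; rewrite !ffunE (inj_eq phi_inj).
by rewrite -val_eqE.
Qed.

Lemma same_kernel_card_le (j' : {ffun T -> J}) : same_kernel j j' ->
  (#|j' @: [set: T]| <= #|j @: [set: T]|)%N.
Proof.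
move=> /same_kernel_ext ->; rewrite -card_S -cardsT.
set phi := finfun _.
apply: leq_trans (leq_imset_card phi _); apply: subset_leq_card.
apply/fintype.subsetP => _ /imsetP[t _ ->]; rewrite ffunE.
exact: imset_f.
Qed.

End Extension.

Lemma same_kernel_card (I J : finType) (j : {ffun T -> I}) (j' : {ffun T -> J}) :
  same_kernel j j' -> #|j' @: [set: T]| = #|j @: [set: T]|.
Proof.
move=> h; apply/eqP; rewrite eqn_leq (same_kernel_card_le h)/=.
by apply: same_kernel_card_le; rewrite same_kernelC.
Qed.

Lemma falling_ge (R : realType) (x : R) r t v : 0 <= x -> (v <= t)%N ->
  x + t%:R <= r%:R -> x ^+ v <= (r ^_ v)%:R.
Proof.
move=> x0 + xr; elim: v => [|v IH] vt; first by rewrite ffactn0.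
rewrite ffactnSr exprSr natrM; apply: ler_pM => //; first exact: exprn_ge0.
  by apply: IH; exact: ltnW.
have rt : (t <= r)%N by rewrite -(ler_nat R); apply: le_trans xr; rewrite lerDr.
rewrite natrB ?(leq_trans (ltnW vt))//.
by rewrite lerBrDr; apply: le_trans xr; rewrite lerD2l ler_nat ltnW.
Qed.

(** Both sides are sums over the ways in which a sequence can repeat itself:
    with [v] distinct values, a pattern is realized by at most [#|I| ^ v]
    sequences over [I], and by at least [(q * #|I|) ^ v] sequences over [J] as
    soon as [J] has [q * #|I|] elements to spare.  This trades a weight [q] for
    a smaller alphabet. *)
Lemma alphabet_reduction (R : realType) (I J : finType) (q : R)
    (F : {ffun T -> I} -> R) (G : {ffun T -> J} -> R) :
  0 <= q -> (0 < #|I|)%N -> q * #|I|%:R + #|T|%:R <= #|J|%:R ->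
  (forall j', 0 <= G j') ->
  (forall j j', same_kernel j j' -> F j = G j') ->
  \sum_(j : {ffun T -> I}) q ^+ #|j @: [set: T]| * F j <= \sum_j' G j'.
Proof.
move=> q0 I0 qIJ G0 FG.
have I0' : 0 < #|I|%:R :> R by rewrite ltr0n.
pose v (j : {ffun T -> I}) := #|j @: [set: T]|.
have step1 j : q ^+ v j * F j <=
    \sum_(j' | same_kernel j j') (#|I|%:R ^- v j) * G j'.
  have -> : q ^+ v j = (q * #|I|%:R) ^+ v j * #|I|%:R ^- v j.
    by rewrite exprMn mulfK// expf_neq0// gt_eqF.
  have ge : (q * #|I|%:R) ^+ v j <= #|[set j' : {ffun T -> J} | same_kernel j j']|%:R.
    apply: (@le_trans _ _ ((#|J| ^_ v j)%:R)).
      apply: falling_ge qIJ; first by rewrite mulr_ge0.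
      by rewrite /v -cardsT; exact: leq_imset_card.
    by rewrite ler_nat card_same_kernel_ge.
  have [j0 j0s|none] := pickP (fun j' : {ffun T -> J} => same_kernel j j').
    rewrite (eq_bigr (fun=> #|I|%:R ^- v j * F j)) => [|j' jj']; last first.
      by rewrite (FG _ _ jj').
    rewrite sumr_const -[leRHS]mulr_natl -mulrA.
    apply: ler_wpM2r; last by move: ge; rewrite cardsE.
    by rewrite mulr_ge0 ?invr_ge0 ?exprn_ge0// (FG _ _ j0s).
  have qv0 : (q * #|I|%:R) ^+ v j = 0.
    apply/eqP; rewrite eq_le exprn_ge0 ?mulr_ge0// andbT.
    apply: le_trans ge _; rewrite lern0 cards_eq0.
    by apply/eqP/setP => j'; rewrite !inE none.
  by rewrite qv0 !mul0r big_pred0.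
apply: le_trans (ler_sum _ (fun j _ => step1 j)) _.
rewrite (exchange_big_dep predT)//=; apply: ler_sum => j' _.
rewrite (eq_bigr (fun=> #|I|%:R ^- #|j' @: [set: T]| * G j')) => [|j jj']; last first.
  by rewrite /v (same_kernel_card jj').
rewrite sumr_const -[leLHS]mulr_natl mulrA; apply: ler_piMl => //.
rewrite ler_pdivrMr ?exprn_gt0// mul1r -natrX ler_nat.
apply: leq_trans (card_same_kernel_le I j'); rewrite cardsE.
by apply: eq_leq; apply: eq_card => j; exact: same_kernelC.
Qed.

End SameKernel.

Lemma covered_twice_kernel m (I I' K K' : finType)
    (j : {ffun 'I_m -> I}) (j' : {ffun 'I_m -> I'})
    (k : {ffun 'I_m -> K}) (k' : {ffun 'I_m -> K'}) :
  same_kernel j j' -> same_kernel k k' ->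
  covered_twice (walk_edge j k) = covered_twice (walk_edge j' k').
Proof.
move=> /same_kernelP jj' /same_kernelP kk'.
apply: eq_forallb => t; apply: eq_existsb => t'.
by rewrite /walk_edge !xpair_eqE jj' kk'.
Qed.

Lemma same_kernel_refl (T I : finType) (j : {ffun T -> I}) : same_kernel j j.
Proof. by apply/same_kernelP. Qed.

Section Comparison.
Variable R : realType.

Definition random_matrix N n (V : finType) (val : 'I_N * 'I_n -> V -> R)
    (c : {ffun 'I_N * 'I_n -> V}) : 'M[R]_(N, n) :=
  \matrix_(j, k) val (j, k) (c (j, k)).

Definition covered_walks r m : R :=
  \sum_(j : {ffun 'I_m -> 'I_r}) \sum_(k : {ffun 'I_m -> 'I_r})
    (covered_twice (walk_edge j k))%:R.

Lemma mean_tr_gram_walks N n (V : finType) (w val : 'I_N * 'I_n -> V -> R) m :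
  product_mean w (fun c => \tr (((random_matrix val c)^T *m random_matrix val c) ^+ m.+1)) =
  \sum_(j : {ffun 'I_m.+1 -> 'I_N}) \sum_(k : {ffun 'I_m.+1 -> 'I_n})
    \prod_e moment w val e (multiplicity (walk_edge j k) e).
Proof.
under [in LHS]eq_fun do rewrite tr_gram_walks.
rewrite product_mean_sum; apply: eq_bigr => j _.
rewrite product_mean_sum; apply: eq_bigr => k _.
rewrite -product_mean_walk; congr product_mean; apply/funext => c.
by apply: eq_bigr => t _; rewrite mxE -surjective_pairing.
Qed.

(** A walk contributes only if it covers each of its edges at least twice; such a walk
    with [e] distinct edges contributes at most [q ^ e <= q ^ (v - 1)], where
    [v] is its number of vertices.  Reducing the two alphabets absorbs
    [q ^ v]: only the walks in a small complete graph remain to be counted. *)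
Lemma mean_tr_gram_le N n (V : finType) (w val : 'I_N * 'I_n -> V -> R) (q : R) r m :
  (forall e v, 0 <= w e v) -> (forall e, \sum_v w e v = 1) ->
  (forall e, moment w val e 1 = 0) ->
  (forall e k, (2 <= k)%N -> `|moment w val e k| <= q) ->
  0 < q -> q <= 1 -> (0 < n)%N -> (n <= N)%N -> q * N%:R + m.+1%:R <= r%:R ->
  product_mean w (fun c => \tr (((random_matrix val c)^T *m random_matrix val c) ^+ m.+1))
    <= q^-1 * covered_walks r m.+1.
Proof.
move=> w0 w1 m1 mk q0 q1 n0 nN qr.
rewrite mean_tr_gram_walks -ler_pdivrMl ?invr_gt0// invrK.
pose F (j : {ffun 'I_m.+1 -> 'I_N}) (k : {ffun 'I_m.+1 -> 'I_n}) : R :=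
  (covered_twice (walk_edge j k))%:R.
apply: (@le_trans _ _ (\sum_(j : {ffun 'I_m.+1 -> 'I_N}) q ^+ #|j @: [set: 'I_m.+1]| *
    \sum_(k : {ffun 'I_m.+1 -> 'I_n}) q ^+ #|k @: [set: 'I_m.+1]| * F j k)).
  rewrite mulr_sumr; apply: ler_sum => j _; rewrite !mulr_sumr.
  apply: ler_sum => k _.
  apply: (@le_trans _ _ (q * (F j k * q ^+ #|walk_edge j k @: [set: 'I_m.+1 * bool]|))).
    by rewrite ler_pM2l//; apply: walk_moment_le.
  rewrite mulrCA -exprS mulrC mulrA -exprD; apply: ler_wpM2r; first exact: ler0n.
  by apply: ler_wiXn2l; [exact: ltW| |exact: walk_edge_card].
apply: (@le_trans _ _ (\sum_(j : {ffun 'I_m.+1 -> 'I_N}) q ^+ #|j @: [set: 'I_m.+1]| *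
    \sum_(k : {ffun 'I_m.+1 -> 'I_r}) (covered_twice (walk_edge j k))%:R)).
  apply: ler_sum => j _; apply: ler_wpM2l; first by rewrite exprn_ge0 ?ltW.
  apply: alphabet_reduction => [||||k k' kk'].
  - exact: ltW.
  - by rewrite card_ord.
  - rewrite !card_ord; apply: le_trans qr.
    by rewrite lerD2r; apply: ler_wpM2l; [exact: ltW|rewrite ler_nat].
  - by move=> k; exact: ler0n.
  - by rewrite /F (covered_twice_kernel (same_kernel_refl j) kk').
apply: alphabet_reduction => [||||j j' jj'].
- exact: ltW.
- by rewrite card_ord (leq_trans n0).
- by rewrite !card_ord.
- by move=> j; apply: sumr_ge0 => k _; exact: ler0n.
- apply: eq_bigr => k _.
  by rewrite (covered_twice_kernel jj' (same_kernel_refl k)).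
Qed.

Lemma covered_walks_le r (V : finType) (w val : 'I_r * 'I_r -> V -> R) m :
  (forall e, \sum_v w e v = 1) ->
  (forall e, moment w val e 1 = 0) ->
  (forall e k, (2 <= k)%N -> 1 <= moment w val e k) ->
  covered_walks r m.+1 <=
  product_mean w (fun c => \tr (((random_matrix val c)^T *m random_matrix val c) ^+ m.+1)).
Proof.
move=> w1 m1 mk; rewrite mean_tr_gram_walks.
by apply: ler_sum => j _; apply: ler_sum => k _; exact: walk_moment_ge.
Qed.

End Comparison.

(** * Sums of two-valued variables *)

Section SignLikeLaw.
Variable R : realType.

(** This two-point law is centered and its moments of order at least two are at
    least [1]: for a matrix of such entries the mean trace dominates the number
    of walks that cover each of their edges twice.  A symmetric law would miss the
    walks that cross an edge an odd number of times. *)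
Definition sign_weight (b : bool) : R := if b then 1 / 3 else 2 / 3.
Definition sign_value (b : bool) : R := if b then 2 else -1.

Lemma sign_weight_ge0 b : 0 <= sign_weight b.
Proof. by case: b; rewrite /sign_weight; lra. Qed.

Lemma sign_weight_sum1 : \sum_b sign_weight b = 1.
Proof. by rewrite big_bool /sign_weight /=; field. Qed.

Lemma sign_mean0 (E : finType) (e : E) :
  moment (fun=> sign_weight) (fun=> sign_value) e 1 = 0.
Proof. by rewrite /moment big_bool/= /sign_weight/sign_value !expr1; field. Qed.

Lemma sign_moment_ge1 (E : finType) (e : E) k : (2 <= k)%N ->
  1 <= moment (fun=> sign_weight) (fun=> sign_value) e k.
Proof.
case: k => [|[|k]]// _; rewrite /moment big_bool/= /sign_weight/sign_value.
have le_2k : 1 <= 2 ^+ k :> R by rewrite exprn_ege1// ler1n.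
have [->|k0] := eqVneq k 0%N; first by rewrite sqrrN expr1n; lra.
have le_2k' : 2 <= 2 ^+ k :> R.
  by rewrite -{1}[2]expr1 ler_eXn2l// ?ltr1n// lt0n.
have : -1 <= (-1) ^+ k.+2 :> R.
  by rewrite -signr_odd; case: odd; rewrite ?expr1 ?expr0//; lra.
by rewrite (exprS 2) (exprS 2 k); lra.
Qed.

(** Averaged against a centered law, the linear term cancels and a Gaussian bound
    on the moment generating function remains. *)
Lemma expR_le_add (x : R) : expR x <= x + expR (2 * x ^+ 2).
Proof.
have sq0 : 0 <= x ^+ 2 := sqr_ge0 x.
have [xh|xh] := leP x (1 / 2); last first.
  apply: (@le_trans _ _ (expR (2 * x ^+ 2))); last by lra.
  by rewrite ler_expR expr2 mulrA ler_peMl; lra.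
apply: (@le_trans _ _ (1 + x + 2 * x ^+ 2)); last first.
  by have := expR_ge1Dx (2 * x ^+ 2); lra.
have x1 : 0 < 1 - x by lra.
rewrite -(ler_pM2r x1); apply: (@le_trans _ _ 1).
  rewrite -[leRHS](expRxMexpNx_1 x) ler_wpM2l ?expR_ge0//.
  exact: expR_ge1Dx.
have -> : (1 + x + 2 * x ^+ 2) * (1 - x) = 1 + x ^+ 2 * (1 - 2 * x) by ring.
by rewrite lerDl mulr_ge0//; lra.
Qed.

Lemma sign_mgf (a : R) :
  \sum_b sign_weight b * expR (a * sign_value b) <= expR (8 * a ^+ 2).
Proof.
rewrite big_bool/= /sign_weight /sign_value.
have h1 := expR_le_add (a * 2); have h2 := expR_le_add (a * -1).
have e1 : 2 * (a * 2) ^+ 2 = 8 * a ^+ 2 by ring.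
have e2 : 2 * (a * -1) ^+ 2 = 2 * a ^+ 2 by ring.
rewrite e1 in h1; rewrite e2 in h2.
have h3 : expR (2 * a ^+ 2) <= expR (8 * a ^+ 2).
  by rewrite ler_expR ler_wpM2r ?sqr_ge0// ler_nat.
lra.
Qed.

Lemma exprn_le_expR (y : R) k : 0 <= y -> y ^+ k <= k%:R ^+ k * expR y.
Proof.
case: k => [|k] y0; first by rewrite !expr0 mul1r -expR0 ler_expR.
have k0 : 0 < k.+1%:R :> R by rewrite ltr0n.
have -> : expR y = expR (y / k.+1%:R) ^+ k.+1.
  by rewrite -expRM_natr divfK// gt_eqF.
rewrite -exprMn lerXn2r ?nnegrE ?mulr_ge0 ?expR_ge0//.
rewrite -ler_pdivrMl// mulrC.
by apply: le_trans (expR_ge1Dx _); rewrite lerDr ler01.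
Qed.

Section Khintchine.
Variable E : finType.

Let mean := @product_mean R E bool (fun=> sign_weight).

Definition sign_sum (a : E -> R) (c : {ffun E -> bool}) : R :=
  \sum_e a e * sign_value (c e).

Lemma mean_expR_sign_sum (a : E -> R) :
  mean (fun c => expR (sign_sum a c)) <= expR (8 * \sum_e a e ^+ 2).
Proof.
rewrite mulr_sumr expR_sum.
have -> : mean (fun c => expR (sign_sum a c)) =
    mean (fun c => \prod_e expR (a e * sign_value (c e))).
  by congr mean; apply/funext => c; rewrite expR_sum.
rewrite /mean (product_mean_prod _ (fun e b => expR (a e * sign_value b))).
apply: ler_prod => e _; rewrite sign_mgf andbT.
by apply: sumr_ge0 => b _; rewrite mulr_ge0 ?sign_weight_ge0 ?expR_ge0.
Qed.

Lemma mean_sign_sum_pow (a : E -> R) m : (0 < m)%N -> \sum_e a e ^+ 2 <= 1 ->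
  mean (fun c => sign_sum a c ^+ (2 * m)) <= 2 * (4 * expR 8 * m%:R) ^+ m.
Proof.
move=> m0 a1; have m0' : 0 < m%:R :> R by rewrite ltr0n.
(* The exponent [l = sqrt m] balances the Gaussian tail against the power. *)
pose l : R := Num.sqrt m%:R.
have l2 : l ^+ 2 = m%:R by rewrite sqr_sqrtr.
pose la e := l * a e; pose nla e := - (l * a e).
have sumla b : (forall e, b e ^+ 2 = m%:R * a e ^+ 2) ->
    mean (fun c => expR (sign_sum b c)) <= expR (8 * m%:R).
  move=> bE; apply: le_trans (mean_expR_sign_sum b) _.
  rewrite ler_expR ler_wpM2l// (eq_bigr _ (fun e _ => bE e)) -mulr_sumr.
  by rewrite ler_piMr.
have pt c : m%:R ^+ m * sign_sum a c ^+ (2 * m) <= (2 * m)%:R ^+ (2 * m) *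
    (expR (sign_sum la c) + expR (sign_sum nla c)).
  have laE : sign_sum la c = l * sign_sum a c.
    by rewrite mulr_sumr; apply: eq_bigr => e _; rewrite mulrA.
  have nlaE : sign_sum nla c = - (l * sign_sum a c).
    rewrite mulr_sumr -sumrN; apply: eq_bigr => e _.
    by rewrite mulNr mulrA.
  rewrite laE nlaE -l2 -exprM -exprMn.
  set y := l * sign_sum a c.
  have -> : y ^+ (2 * m) = `|y| ^+ (2 * m) by rewrite !exprM real_normK ?num_real.
  apply: le_trans (exprn_le_expR _ (normr_ge0 y)) _.
  rewrite ler_wpM2l ?exprn_ge0//.
  case: (ger0P y) => _; [by rewrite lerDl expR_ge0|by rewrite lerDr expR_ge0].
have h : m%:R ^+ m * mean (fun c => sign_sum a c ^+ (2 * m)) <=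
    (2 * m)%:R ^+ (2 * m) * (expR (8 * m%:R) + expR (8 * m%:R)).
  rewrite /mean /product_mean mulr_sumr.
  apply: (@le_trans _ _ (\sum_c product_law (fun=> sign_weight) c *
      ((2 * m)%:R ^+ (2 * m) * (expR (sign_sum la c) + expR (sign_sum nla c))))).
    apply: ler_sum => c _; rewrite mulrCA ler_wpM2l//.
    by apply: product_law_ge0 => _; exact: sign_weight_ge0.
  under eq_bigr do rewrite mulrCA mulrDr.
  rewrite -mulr_sumr big_split/= ler_wpM2l ?exprn_ge0//.
  by apply: lerD; apply: sumla => e; rewrite /la /nla ?sqrrN exprMn l2.
rewrite -(ler_pM2l (exprn_gt0 m m0')); apply: le_trans h _.
rewrite le_eqVlt; apply/orP; left; apply/eqP.
have -> : (2 * m)%:R ^+ (2 * m) = (4 * m%:R) ^+ m * m%:R ^+ m :> R.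
  by rewrite exprM -exprMn; congr (_ ^+ _); rewrite natrM; ring.
by rewrite expRM_natr !exprMn; ring.
Qed.

End Khintchine.
End SignLikeLaw.

(** * A net of the unit ball *)

Section Net.
Variables (R : realType) (r : nat).
Hypothesis r0 : (0 < r)%N.

(** Vectors with coordinates in [Z / (4 sqrt r)], encoded by signs and
    magnitudes; magnitudes up to [4 r] suffice inside the unit ball because
    [sqrt r <= r]. *)
Definition grid := {ffun 'I_r -> bool * 'I_(4 * r).+1}.

Let step : R := (4 * Num.sqrt r%:R)^-1.

Definition grid_vector (z : grid) : 'rV[R]_r :=
  \row_i ((-1) ^+ (z i).1 * (val (z i).2)%:R * step).

Definition net_point (z : grid) : bool := dot (grid_vector z) (grid_vector z) <= 1.

Let sqrt_r2 : Num.sqrt r%:R ^+ 2 = r%:R :> R.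
Proof. by rewrite sqr_sqrtr. Qed.

Let sqrt_r_gt0 : 0 < Num.sqrt r%:R :> R.
Proof. by rewrite sqrtr_gt0 ltr0n. Qed.

Let step_gt0 : 0 < step.
Proof. by rewrite invr_gt0 mulr_gt0. Qed.

Let step2 : step ^+ 2 = (16 * r%:R)^-1.
Proof. by rewrite exprVn exprMn sqrt_r2; congr (_^-1); ring. Qed.

(** Rounding each coordinate towards zero keeps the point in the unit ball. *)
Lemma net_approx (u : 'rV[R]_r) : dot u u <= 1 ->
  exists2 z, net_point z & dot (4 *: (u - grid_vector z)) (4 *: (u - grid_vector z)) <= 1.
Proof.
move=> u1.
have ui1 i : `|u 0 i| <= 1.
  rewrite -(@ler_pXn2r _ 2) ?nnegrE//= expr1n real_normK ?num_real//.
  apply: le_trans u1; rewrite dotvv (bigD1 i)//= lerDl.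
  by apply: sumr_ge0 => j _; exact: sqr_ge0.
pose t i := Num.trunc (`|u 0 i| / step).
have tP i : (t i)%:R * step <= `|u 0 i| < (t i)%:R * step + step.
  have /andP[h1 h2] : (t i)%:R <= `|u 0 i| / step < (t i).+1%:R.
    by apply: truncn_itv; apply: divr_ge0 => //; exact: ltW.
  rewrite -ler_pdivlMr// h1/=.
  by move: h2; rewrite ltr_pdivrMr// -natr1 mulrDl mul1r.
have t_le i : (t i < (4 * r).+1)%N.
  rewrite ltnS -(ler_nat R).
  have /andP[h _] := tP i; move: h; rewrite -ler_pdivlMr// => /le_trans; apply.
  rewrite invrK natrM; apply: (@le_trans _ _ (1 * (4 * Num.sqrt r%:R))).
    by apply: ler_wpM2r; rewrite ?ui1// mulr_ge0.
  rewrite mul1r; apply: ler_wpM2l => //.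
  rewrite -[leRHS]sqrt_r2 expr2; apply: ler_peMl; first exact: ltW.
  by rewrite -[leLHS]sqrtr1 ler_sqrt ?ler0n// ler1n.
pose z : grid := [ffun i => (u 0 i < 0, Ordinal (t_le i))].
have zE i : grid_vector z 0 i = (-1) ^+ (u 0 i < 0)%R * ((t i)%:R * step).
  by rewrite mxE ffunE/= mulrA.
exists z.
  apply: le_trans u1; rewrite !dotvv; apply: ler_sum => i _.
  rewrite zE exprMn sqrr_sign mul1r -[leRHS]real_normK ?num_real//.
  have /andP[h _] := tP i; rewrite lerXn2r// nnegrE mulr_ge0// ltW//.
rewrite dotvv; apply: (@le_trans _ _ (\sum_(i < r) 16 * step ^+ 2)).
  apply: ler_sum => i _; rewrite mxE exprMn [X in 4 ^+ 2 * X ^+ 2]mxE [X in _ + X]mxE zE.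
  have -> : (4 : R) ^+ 2 = 16 by ring.
  rewrite ler_pM2l// {1}[u 0 i]numEsign -mulrBr exprMn sqrr_sign mul1r.
  rewrite lerXn2r ?nnegrE ?(ltW step_gt0)//; have /andP[h1 h2] := tP i; lra.
rewrite sumr_const card_ord step2 -[leLHS]mulr_natr.
have r_neq0 : r%:R != 0 :> R by rewrite pnatr_eq0 -lt0n.
by rewrite mulrAC divff// mulf_neq0.
Qed.

Lemma sum_grid_weight :
  \sum_(x : bool * 'I_(4 * r).+1) (2 : R)^-1 ^+ val x.2 <= 4.
Proof.
rewrite -(pair_bigA _ (fun (b : bool) (t : 'I_(4 * r).+1) => (2 : R)^-1 ^+ t))/=.
have half n : \sum_(t < n) (2 : R)^-1 ^+ t = 2 - 2 * 2^-1 ^+ n.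
  elim: n => [|n IH]; first by rewrite big_ord0 expr0; ring.
  by rewrite big_ord_recr/= IH exprS; field.
rewrite big_bool/= half; have : 0 <= (2 : R)^-1 ^+ (4 * r).+1 by rewrite exprn_ge0.
lra.
Qed.

(** Grid points of the unit ball have magnitudes of total at most [16 r], so the
    weight [2 ^ (- total)] bounds their number. *)
Lemma card_net : #|[set z | net_point z]|%:R <= (4 * 2 ^+ 16) ^+ r :> R.
Proof.
rewrite -sum1_card natr_sum.
apply: (@le_trans _ _ (\sum_(z : grid) 2 ^+ (16 * r) * \prod_i 2^-1 ^+ val (z i).2)).
  rewrite [leRHS](bigID (fun z => z \in [set z | net_point z]))/=.
  rewrite -[leLHS]addr0; apply: lerD; last first.
    by apply: sumr_ge0 => z _; rewrite mulr_ge0 ?exprn_ge0// prodr_ge0// => i _; rewrite exprn_ge0.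
  apply: ler_sum => z; rewrite inE => zn.
  rewrite -expr_sum exprVn ler_pdivlMr ?exprn_gt0// mul1r.
  rewrite ler_eXn2l ?ltr1n// -(ler_nat R) natr_sum.
  have sq : \sum_i ((val (z i).2)%:R ^+ 2 : R) <= (16 * r)%:R.
    move: zn; rewrite /net_point dotvv.
    under eq_bigr do rewrite mxE !exprMn sqrr_sign mul1r.
    by rewrite -mulr_suml step2 ler_pdivrMr ?mulr_gt0 ?ltr0n// mul1r natrM.
  apply: le_trans sq; apply: ler_sum => i _.
  rewrite -natrX ler_nat /=; move: (nat_of_ord _) => [|t]//.
  by rewrite expnS leq_pmulr ?expn_gt0.
rewrite -mulr_sumr -(bigA_distr_bigA (fun (_ : 'I_r) (x : bool * 'I_(4 * r).+1) => (2 : R)^-1 ^+ val x.2))/=.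
rewrite prodr_const card_ord exprM -exprMn; apply: lerXn2r.
- by rewrite nnegrE mulr_ge0 ?exprn_ge0// sumr_ge0// => x _; rewrite exprn_ge0.
- by rewrite nnegrE mulr_ge0 ?exprn_ge0.
- by rewrite mulrC ler_wpM2r ?exprn_ge0// sum_grid_weight.
Qed.

(** If [b] bounds the form on the unit ball, then so does [M + b / 2]: move both
    vectors to grid points at distance at most [1 / 4], at a cost of [b / 4] each.
    Iterating from any finite bound decreases it to [2 M]. *)
Lemma net_bilinear_bound (H : 'M[R]_r) (M : R) :
  (forall x y, net_point x -> net_point y ->
     dot (grid_vector x *m H) (grid_vector y) <= M) ->
  forall u v : 'rV[R]_r, dot (u *m H) v <= 2 * M * (enorm u * enorm v).
Proof.
move=> HM.
pose bounded b := forall u v : 'rV[R]_r,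
  dot u u <= 1 -> dot v v <= 1 -> dot (u *m H) v <= b.
have halve b : bounded b -> bounded (M + b / 2).
  move=> bb u v u1 v1.
  have [x xn xu] := net_approx u1; have [y yn yv] := net_approx v1.
  have -> : dot (u *m H) v = dot (grid_vector x *m H) (grid_vector y) +
      4^-1 * dot ((4 *: (u - grid_vector x)) *m H) (grid_vector y) +
      4^-1 * dot (u *m H) (4 *: (v - grid_vector y)).
    rewrite -scalemxAl dotZl dotZr !mulKf// mulmxBl dotDl dotDr.
    by rewrite dotNl dotNr; ring.
  have := HM _ _ xn yn; have := bb _ _ xu yn; have := bb _ _ u1 yv; lra.
pose b0 := \sum_i \sum_j `|H i j|.
have coord (u : 'rV[R]_r) i : dot u u <= 1 -> `|u 0 i| <= 1.
  move=> u1; rewrite -(@ler_pXn2r _ 2) ?nnegrE//= expr1n real_normK ?num_real//.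
  apply: le_trans u1; rewrite dotvv (bigD1 i)//= lerDl.
  by apply: sumr_ge0 => j _; exact: sqr_ge0.
have bd0 : bounded b0.
  move=> u v u1 v1; rewrite dotE /b0 exchange_big/=; apply: ler_sum => j _.
  rewrite mxE mulr_suml; apply: ler_sum => i _.
  apply: le_trans (ler_norm _) _; rewrite !normrM.
  rewrite -[leRHS]mulr1; apply: ler_pM; rewrite ?mulr_ge0//; last exact: coord.
  by rewrite -[leRHS]mul1r; apply: ler_pM => //; exact: coord.
have bdk k : bounded (2 * M + b0 / 2 ^+ k).
  elim: k => [|k IH] u v u1 v1.
    have := halve _ bd0 u v u1 v1.
    rewrite expr0 divr1.
    have M0 : 0 <= M.
      have z0 : net_point [ffun=> (false, ord0)].
        rewrite /net_point dotvv big1// => i _.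
        by rewrite mxE ffunE/= mulr0 mul0r expr0n.
      apply: le_trans (HM _ _ z0 z0); rewrite dotE big1// => i _.
      by rewrite [X in _ * X]mxE ffunE/= mulr0 mul0r mulr0.
    have b00 : 0 <= b0 by apply: sumr_ge0 => i _; apply: sumr_ge0.
    lra.
  apply: le_trans (halve _ IH u v u1 v1) _.
  rewrite le_eqVlt; apply/orP; left; apply/eqP.
  by rewrite exprS invfM; field; rewrite expf_neq0.
have bd : bounded (2 * M).
  move=> u v u1 v1; rewrite leNgt; apply/negP => lt.
  set x := dot _ _ in lt; have e0 : 0 < x - 2 * M by rewrite subr_gt0.
  have b00 : 0 <= b0 by apply: sumr_ge0 => i _; apply: sumr_ge0.
  have kP : b0 / (x - 2 * M) < 2 ^+ (Num.trunc (b0 / (x - 2 * M))).+1.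
    have /andP[_ h] := @truncn_itv R (b0 / (x - 2 * M)) (divr_ge0 b00 (ltW e0)).
    by apply: lt_trans h _; rewrite -natrX ltr_nat ltn_expl.
  have := bdk (Num.trunc (b0 / (x - 2 * M))).+1 u v u1 v1.
  rewrite -/x -lerBlDl leNgt => /negP; apply.
  by rewrite ltr_pdivrMr ?exprn_gt0// mulrC -ltr_pdivrMr.
move=> u v.
have zero (w : 'rV[R]_r) : enorm w = 0 -> w = 0.
  by move=> w0; apply/eqP; apply: contraT => /dot_gt0; rewrite -enorm2 w0 expr0n ltxx.
have [u0|u0] := eqVneq (enorm u) 0.
  by rewrite (zero _ u0) mul0mx /enorm /dot !mul0mx !mxE sqrtr0 mul0r mulr0.
have [v0|v0] := eqVneq (enorm v) 0.
  by rewrite (zero _ v0) /enorm /dot trmx0 !mulmx0 !mxE sqrtr0 mulr0 mulr0.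
have up : 0 < enorm u by rewrite lt_neqAle eq_sym u0 enorm_ge0.
have vp : 0 < enorm v by rewrite lt_neqAle eq_sym v0 enorm_ge0.
have unit (w : 'rV[R]_r) : enorm w != 0 -> dot ((enorm w)^-1 *: w) ((enorm w)^-1 *: w) <= 1.
  by move=> w0; rewrite dotZl dotZr mulrA -invfM -expr2 -enorm2 mulVf// expf_neq0.
have := bd _ _ (unit _ u0) (unit _ v0).
by rewrite -scalemxAl dotZl dotZr mulrA -invfM mulrC ler_pdivrMr// mulr_gt0.
Qed.

End Net.

(** * Counting the closed walks *)

Section CoveredWalks.
Variable R : realType.

Lemma sum_pair (I J : finType) (F : I * J -> R) :
  \sum_e F e = \sum_i \sum_j F (i, j).
Proof. by rewrite pair_bigA/=; apply: eq_bigr => -[]. Qed.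

(** The operator norm is at most twice the largest of the forms at the net points,
    and the [2 m]-th power of the largest is at most the sum of all of them. *)
Lemma tr_gram_pow_le_net r (H : 'M[R]_r) m : (0 < r)%N ->
  \tr ((H^T *m H) ^+ m) <= r%:R * 4 ^+ m *
    \sum_(p : grid r * grid r | net_point R p.1 && net_point R p.2)
       dot (grid_vector R p.1 *m H) (grid_vector R p.2) ^+ (2 * m).
Proof.
move=> r0.
pose F (p : grid r * grid r) := `|dot (grid_vector R p.1 *m H) (grid_vector R p.2)|.
pose A (p : grid r * grid r) := net_point R p.1 && net_point R p.2.
have z0 : net_point R [ffun=> (false, ord0) : bool * 'I_(4 * r).+1].
  rewrite /net_point dotvv big1// => i _.
  by rewrite mxE ffunE/= mulr0 mul0r expr0n.
have Az0 : A ([ffun=> (false, ord0)], [ffun=> (false, ord0)]) by rewrite /A/= z0.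
have [p Ap pmax] := arg_maxP F Az0.
have HM x y : net_point R x -> net_point R y ->
    dot (grid_vector R x *m H) (grid_vector R y) <= F p.
  move=> xn yn; apply: le_trans (ler_norm _) _; apply: (pmax (x, y)).
  by rewrite /A/= xn.
have F0 : 0 <= F p by exact: normr_ge0.
apply: le_trans (tr_gram_pow_le m _ (net_bilinear_bound r0 HM)) _.
  by rewrite mulr_ge0.
rewrite -mulrA; apply: ler_wpM2l; first exact: ler0n.
have -> : (2 * F p) ^+ (2 * m) = 4 ^+ m * F p ^+ (2 * m).
  by rewrite exprMn (exprM 2); congr (_ ^+ _ * _); ring.
apply: ler_wpM2l; first by rewrite exprn_ge0.
rewrite exprM real_normK ?num_real// -exprM (bigD1 p)//= lerDl.
by apply: sumr_ge0 => q _; rewrite exprM exprn_ge0// sqr_ge0.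
Qed.

Definition walk_const : R := 4 * (4 * ((4 * 2 ^+ 16) ^+ 4 * (4 * expR 8))).

Lemma walk_const_gt0 : 0 < walk_const.
Proof. by rewrite !mulr_gt0 ?exprn_gt0 ?expR_gt0. Qed.

(** The matrix has size [2 * m.+1], so the [exp(O(m))] pairs of net points cost no
    more than the factor [exp(O(m))] that the bound leaves room for. *)
Lemma covered_walks_bound m :
  covered_walks R (2 * m.+1) m.+1 <= (walk_const * m.+1%:R) ^+ m.+1.
Proof.
set M := m.+1; set r := (2 * M)%N.
have r0 : (0 < r)%N by [].
pose w (_ : 'I_r * 'I_r) := @sign_weight R; pose s (_ : 'I_r * 'I_r) := @sign_value R.
have w0 e v : 0 <= w e v by exact: sign_weight_ge0.
apply: le_trans (@covered_walks_le R r _ w s m _ _ _) _.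
- by move=> e; exact: sign_weight_sum1.
- by move=> e; exact: sign_mean0.
- by move=> e k; exact: sign_moment_ge1.
rewrite -/M.
pose a (p : grid r * grid r) (e : 'I_r * 'I_r) :=
  grid_vector R p.1 0 e.1 * grid_vector R p.2 0 e.2.
have dotE' c p : dot (grid_vector R p.1 *m random_matrix s c) (grid_vector R p.2) =
    sign_sum (a p) c.
  rewrite dotE /sign_sum sum_pair.
  rewrite exchange_big/=; apply: eq_bigr => j _.
  rewrite [(_ *m _) _ _]mxE mulr_suml.
  by apply: eq_bigr => i _; rewrite [random_matrix s c i j]mxE /a/= mulrAC.
have a1 p : net_point R p.1 -> net_point R p.2 -> \sum_e a p e ^+ 2 <= 1.
  move=> p1 p2.
  have -> : \sum_e a p e ^+ 2 =
      dot (grid_vector R p.1) (grid_vector R p.1) * dot (grid_vector R p.2) (grid_vector R p.2).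
    rewrite !dotvv mulr_suml sum_pair.
    apply: eq_bigr => i _; rewrite mulr_sumr; apply: eq_bigr => j _.
    by rewrite exprMn.
  by rewrite -[leRHS]mulr1; apply: ler_pM; [exact: dot_ge0|exact: dot_ge0|exact: p1|exact: p2].
pose K : R := 2 * (4 * expR 8 * M%:R) ^+ M.
have K0 : 0 <= K by rewrite mulr_ge0 ?exprn_ge0 ?mulr_ge0 ?expR_ge0.
apply: le_trans (le_product_mean w0 (fun c => tr_gram_pow_le_net _ M r0)) _.
pose S c := \sum_(p : grid r * grid r | net_point R p.1 && net_point R p.2)
  sign_sum (a p) c ^+ (2 * M).
have -> : product_mean w (fun c => r%:R * 4 ^+ M *
    \sum_(p : grid r * grid r | net_point R p.1 && net_point R p.2)
       dot (grid_vector R p.1 *m random_matrix s c) (grid_vector R p.2) ^+ (2 * M)) =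
    r%:R * 4 ^+ M * product_mean w S.
  rewrite [RHS]mulr_sumr; apply: eq_bigr => c _; rewrite [RHS]mulrCA; congr (_ * (_ * _)).
  by apply: eq_bigr => p _; rewrite dotE'.
have SK : product_mean w S <= (4 * 2 ^+ 16) ^+ r * (4 * 2 ^+ 16) ^+ r * K.
  rewrite /product_mean /S; under eq_bigr do rewrite mulr_sumr.
  rewrite exchange_big/=.
  apply: (@le_trans _ _ (\sum_(p : grid r * grid r | net_point R p.1 && net_point R p.2) K)).
    by apply: ler_sum => p /andP[p1 p2]; apply: mean_sign_sum_pow => //; exact: a1.
  rewrite -(pair_big (net_point R (r := r)) (net_point R (r := r)) (fun _ _ => K))/=.
  rewrite !sumr_const -mulrnA -[leLHS]mulr_natl natrM.
  by apply: ler_wpM2r => //; apply: ler_pM => //; have := @card_net R r r0; rewrite cardsE.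
apply: le_trans (ler_wpM2l _ SK) _; first by rewrite mulr_ge0 ?exprn_ge0.
have M4 : (4 * M)%:R <= 4 ^+ M :> R.
  rewrite -natrX ler_nat /M; elim: (m) => // k IH.
  by rewrite expnS; apply: leq_trans (leq_mul (leqnn 4) IH); lia.
set D : R := 4 * 2 ^+ 16.
have D0 : 0 < D by rewrite mulr_gt0 ?exprn_gt0.
have -> : r%:R * 4 ^+ M * (D ^+ r * D ^+ r * K) =
    (4 * M)%:R * (4 * (D ^+ 4 * (4 * expR 8)) * M%:R) ^+ M.
  have -> : D ^+ r * D ^+ r = (D ^+ 4) ^+ M.
    by rewrite -exprD -exprM; congr (_ ^+ _); rewrite /r; lia.
  by rewrite /K /r !natrM !exprMn; ring.
have -> : (walk_const * M%:R) ^+ M =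
    4 ^+ M * (4 * (D ^+ 4 * (4 * expR 8)) * M%:R) ^+ M.
  by rewrite -exprMn /walk_const -/D !mulrA.
apply: ler_wpM2r M4.
by rewrite exprn_ge0 ?mulr_ge0 ?exprn_ge0 ?(ltW D0) ?expR_ge0.
Qed.

End CoveredWalks.

Section DiscreteTail.
Variable R : realType.

Lemma moment_le (E V : finType) (w val : E -> V -> R) (q : R) e k :
  (forall v, 0 <= w e v) -> (forall v, `|val e v| <= 1) ->
  moment w val e 2 <= q -> (2 <= k)%N -> `|moment w val e k| <= q.
Proof.
move=> w0 val1 m2; case: k => [|[|k]]// _; apply: le_trans m2.
apply: le_trans (ler_norm_sum _ _ _) _; apply: ler_sum => v _.
rewrite normrM (ger0_norm (w0 v)); apply: ler_wpM2l => //.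
rewrite normrX -[leRHS]real_normK ?num_real//.
by apply: ler_wiXn2l.
Qed.

Lemma tr_gram_tail N n (V : finType) (w val : 'I_N * 'I_n -> V -> R) (q t : R) m :
  (forall e v, 0 <= w e v) -> (forall e, \sum_v w e v = 1) ->
  (forall e v, `|val e v| <= 1) ->
  (forall e, moment w val e 1 = 0) ->
  (forall e, moment w val e 2 <= q) ->
  0 < q -> q <= 1 -> (0 < n)%N -> (n <= N)%N -> q * N%:R <= m.+1%:R -> 0 < t ->
  (forall c, 0 <= \tr (((random_matrix val c)^T *m random_matrix val c) ^+ m.+1)) ->
  \sum_(c | t <= \tr (((random_matrix val c)^T *m random_matrix val c) ^+ m.+1))
      product_law w c
    <= t^-1 * (q^-1 * (walk_const R * m.+1%:R) ^+ m.+1).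
Proof.
move=> w0 w1 v1 m1 m2 q0 q1 n0 nN qN t0 tr0.
apply: le_trans (product_mean_markov w0 t0 tr0) _.
rewrite ler_pM2l ?invr_gt0//.
have mk e k : (2 <= k)%N -> `|moment w val e k| <= q by apply: moment_le.
apply: le_trans (mean_tr_gram_le (r := (2 * m.+1)%N) w0 w1 m1 mk q0 q1 n0 nN _) _.
  by rewrite natrM mulr_natl mulr2n lerD2r.
by rewrite ler_pM2l ?invr_gt0// covered_walks_bound.
Qed.

End DiscreteTail.

(** * Measurability of the largest singular value *)

Local Open Scope classical_set_scope.
Local Open Scope ring_scope.

Section Measurability.
Variable R : realType.

Lemma char_poly_horner n (A : 'M[R]_n) x : (char_poly A).[x] = \det (x%:M - A).
Proof.
rewrite /char_poly -horner_evalE -det_map_mx; congr (\det _).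
apply/matrixP => i j; rewrite !mxE rmorphB rmorphMn /=.
by rewrite !horner_evalE hornerX hornerC.
Qed.

Lemma singular_values_bounded N n (M : 'M[R]_(N, n)) : (n <= N)%N ->
  has_ubound (singular_values M).
Proof.
move=> nN; exists (N%:R * \sum_j \sum_k `|M j k|) => s.
move=> /singular_value_vector[v v1 <-]; apply: enorm_mulmx_le_entries => //.
  by apply: sumr_ge0 => j _; apply: sumr_ge0.
move=> j k; rewrite (bigD1 j)//= (bigD1 k)//= -addrA lerDl.
by apply: addr_ge0; apply: sumr_ge0 => // i _; apply: sumr_ge0.
Qed.

(** The squares of the singular values are the nonnegative zeros of a polynomial,
    so they form a closed set, which contains its supremum. *)
Lemma le_largest_singular_value N n (M : 'M[R]_(N, n)) t : (n <= N)%N -> 0 < t ->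
  (t <= largest_singular_value M) <-> exists2 s, singular_values M s & t <= s.
Proof.
move=> nN t0; have ubM := singular_values_bounded M nN.
split=> [|[s Ms ts]]; last exact: le_trans ts (ub_le_sup ubM Ms).
rewrite /largest_singular_value.
have [->|/set0P M0] := eqVneq (singular_values M) set0.
  by rewrite sup0 leNgt t0.
move=> tM; exists (sup (singular_values M)) => //.
pose S := [set s : R | 0 <= s] `&`
    (horner (char_poly (M^T *m M) \Po 'X^2)) @^-1` [set x | x = 0].
have SE : singular_values M = S.
  apply/seteqP; split=> s; rewrite /singular_values/S/= eigenvalue_root_char.
    by move=> [s0 /rootP]; rewrite horner_comp hornerXn.
  by move=> [s0]; rewrite horner_comp hornerXn => /rootP.
have Sclosed : closed S.
  apply: closedI; first exact: closed_ge.
  by apply: preimage_closed; [move=> x _; exact: continuous_horner|exact: closed_eq].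
rewrite SE in M0 ubM *.
exact/Sclosed/closure_sup.
Qed.

(** Near zeros at points of a compact interval yield a zero by the extreme value
    theorem, and conversely a zero is approached by rational points; the existence
    of a zero is thereby reduced to countably many inequalities. *)
Lemma horner_zero_rational (p : {poly R}) (c : R) :
  (exists2 x, c <= x & root p x) <->
  exists L : nat, forall k : nat, exists a b : nat,
    (a <= L * b.+1)%N /\ `|p.[c + a%:R / b.+1%:R]| < k.+1%:R^-1.
Proof.
split=> [[x cx /rootP px]|[L Lk]].
  exists (Num.trunc (x - c)).+1 => k.
  have xc0 : 0 <= x - c by rewrite subr_ge0.
  have : p.[y] @[y --> x] --> (0 : R) by rewrite -px; exact: continuous_horner.
  move=> /cvgrPdist_lt/(_ k.+1%:R^-1); rewrite invr_gt0 ltr0n => /(_ isT).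
  move=> /nbhs_ballP[e /= e0 pe].
  pose b := Num.trunc e^-1; pose a := Num.trunc ((x - c) * b.+1%:R).
  have b0 : 0 < b.+1%:R :> R by rewrite ltr0n.
  have /andP[_ bP] : b%:R <= e^-1 < b.+1%:R by apply: truncn_itv; rewrite invr_ge0 ltW.
  have /andP[aP1 aP2] : a%:R <= (x - c) * b.+1%:R < a.+1%:R.
    by apply: truncn_itv; rewrite mulr_ge0.
  exists a, b; split.
    rewrite -(ler_nat R); apply: le_trans aP1 _; rewrite natrM ler_wpM2r//.
    by have /andP[_ /ltW] := truncn_itv xc0.
  have := pe (c + a%:R / b.+1%:R); rewrite /ball/= sub0r normrN; apply.
  rewrite opprD addrA ger0_norm; last by rewrite subr_ge0 ler_pdivrMr.
  rewrite ltrBlDl -ltrBlDr ltr_pdivlMr// mulrBl.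
  rewrite ltrBlDr; apply: lt_trans aP2 _; rewrite -natr1 ltrD2l.
  by rewrite -(ltr_pdivrMl _ _ e0) mulr1.
have cont : {within `[c, c + L%:R], continuous (fun x => `|p.[x]|)}.
  apply: continuous_subspaceT => x.
  by apply: continuous_comp; [exact: continuous_horner|exact: norm_continuous].
have cL : c <= c + L%:R by rewrite lerDl.
have [x xin xmin] := EVT_min cL cont.
exists x; first by move: xin; rewrite in_itv/= => /andP[].
apply/rootP/eqP; rewrite -normr_eq0; apply: contraT => px0.
have {px0}px0 : 0 < `|p.[x]| by rewrite lt_neqAle eq_sym px0 normr_ge0.
have /andP[_ kP] : (Num.trunc `|p.[x]|^-1)%:R <= `|p.[x]|^-1 <
    (Num.trunc `|p.[x]|^-1).+1%:R by apply: truncn_itv; rewrite invr_ge0.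
have [a [b [ab pz]]] := Lk (Num.trunc `|p.[x]|^-1).
have b0 : 0 < b.+1%:R :> R by rewrite ltr0n.
have := xmin (c + a%:R / b.+1%:R); rewrite in_itv/= lerDl divr_ge0//= lerD2l.
rewrite ler_pdivrMr// -natrM ler_nat ab leNgt => /(_ isT)/negP[].
apply: lt_trans pz _; rewrite -[ltRHS]invrK ltf_pV2 ?posrE ?invr_gt0//.
Qed.

Lemma measurable_det d (T : measurableType d) n (A : T -> 'M[R]_n) :
  (forall i j, measurable_fun setT (fun w => A w i j)) ->
  measurable_fun setT (fun w => \det (A w)).
Proof.
move=> mA; apply: measurable_sum => s; apply: measurable_funM => //.
exact: measurable_prod.
Qed.

Lemma measurable_le_largest_singular_value d (T : measurableType d) N n
    (M : T -> 'M[R]_(N, n)) t : (n <= N)%N -> 0 < t ->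
  (forall j k, measurable_fun setT (fun w => M w j k)) ->
  measurable [set w | t <= largest_singular_value (M w)].
Proof.
move=> nN t0 mM.
pose f x w := \det (x%:M - (M w)^T *m M w).
have mf x : measurable_fun setT (f x).
  apply: measurable_det => i j.
  have -> : (fun w => (x%:M - (M w)^T *m M w) i j) =
      (fun w => x *+ (i == j) - \sum_k M w k i * M w k j).
    by apply/funext => w; rewrite !mxE; congr (_ - _); apply: eq_bigr => k _; rewrite mxE.
  apply: measurable_funB => //; apply: measurable_sum => k.
  exact: measurable_funM.
have -> : [set w | t <= largest_singular_value (M w)] =
    \bigcup_L \bigcap_k \bigcup_a \bigcup_b
      (if (a <= L * b.+1)%N
       then [set w | `|f (t ^+ 2 + a%:R / b.+1%:R) w| < k.+1%:R^-1] else set0).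
  apply/seteqP; split=> w /=.
    move=> /(le_largest_singular_value _ nN t0)[s [s0]].
    rewrite eigenvalue_root_char => rs ts.
    have /horner_zero_rational[L Lk] : exists2 x, t ^+ 2 <= x &
        root (char_poly ((M w)^T *m M w)) x.
      by exists (s ^+ 2) => //; rewrite lerXn2r ?nnegrE// ltW.
    exists L => // k _; have [a [b [ab h]]] := Lk k.
    by exists a => //; exists b => //; rewrite ab/= /f -char_poly_horner.
  move=> [L _ Lk]; apply/(le_largest_singular_value _ nN t0).
  have /horner_zero_rational[x tx rx] : exists L : nat, forall k : nat, exists a b : nat,
    (a <= L * b.+1)%N /\
    `|(char_poly ((M w)^T *m M w)).[t ^+ 2 + a%:R / b.+1%:R]| < k.+1%:R^-1.
    exists L => k; have [a _ [b _]] := Lk k I.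
    by case: ifP => // ab h; exists a, b; rewrite char_poly_horner.
  have x0 : 0 <= x by apply: le_trans tx; exact: sqr_ge0.
  exists (Num.sqrt x); last first.
    by rewrite -[t]ger0_norm ?(ltW t0)// -sqrtr_sqr ler_sqrt.
  split; first exact: sqrtr_ge0.
  by rewrite sqr_sqrtr// eigenvalue_root_char.
apply: bigcupT_measurable => L; apply: bigcapT_measurable => k.
apply: bigcupT_measurable => a; apply: bigcupT_measurable => b.
case: ifP => // _.
have mn : measurable_fun setT (fun w => `|f (t ^+ 2 + a%:R / b.+1%:R) w|).
  exact: measurableT_comp.
rewrite -[X in measurable X]setTI.
have -> : [set w | `|f (t ^+ 2 + a%:R / b.+1%:R) w| < k.+1%:R^-1] =
  (fun w => `|f (t ^+ 2 + a%:R / b.+1%:R) w|) @^-1` `]-oo, k.+1%:R^-1[%classic.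
  by apply/seteqP; split => w; rewrite /= in_itv.
exact: mn.
Qed.

End Measurability.

(** * Finitely valued random variables and truncated moments *)

Section FiniteValued.
Context {d : measure_display} {T : measurableType d} {R : realType}.
Variables (P : probability T R) (U : finType) (G : T -> U).
Hypothesis mG : forall u, measurable (G @^-1` [set u]).

Lemma measurable_finite_preimage (A : pred U) : measurable [set w | A (G w)].
Proof.
have -> : [set w | A (G w)] = \bigcup_(u in [set u | A u]) (G @^-1` [set u]).
  apply/seteqP; split=> w /=; first by move=> Aw; exists (G w).
  by move=> [u Au /= ->].
apply: fin_bigcup_measurable => //; exact: finite_finset.
Qed.

Lemma probability_finite_preimage (A : pred U) :
  P [set w | A (G w)] = (\sum_(u | A u) P (G @^-1` [set u]))%E.
Proof.
have seqP (s : seq U) : uniq s ->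
    P [set w | G w \in s] = (\sum_(u <- s) P (G @^-1` [set u]))%E.
  elim: s => [|u s IH] /=.
    move=> _; rewrite big_nil (_ : [set w | _] = set0) ?measure0//.
    by apply/seteqP; split=> w.
  move=> /andP[us /IH sE]; rewrite big_cons -sE.
  have -> : [set w | G w \in u :: s] = (G @^-1` [set u]) `|` [set w | G w \in s].
    apply/seteqP; split=> w /=; rewrite inE; first by move=> /predU1P.
    by move=> [->|->]; rewrite ?eqxx ?orbT.
  rewrite measureU//; first exact: (measurable_finite_preimage (mem s)).
  apply/seteqP; split=> w //= [-> us']; by rewrite us' in us.
rewrite -big_enum/= -seqP ?enum_uniq//; congr (P _).
by apply/seteqP; split=> w /=; rewrite mem_enum.
Qed.

Lemma measurable_finite_comp (F : U -> R) : measurable_fun setT (F \o G).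
Proof.
move=> _ Y _; rewrite setTI.
have -> : (F \o G) @^-1` Y = [set w | `[< Y (F (G w)) >]].
  by apply/seteqP; split=> w /=; rewrite asboolE.
exact: (measurable_finite_preimage (fun u => `[< Y (F u) >])).
Qed.

Lemma expectation_finite_valued (F : U -> R) :
  ('E_P[F \o G])%E = (\sum_u fine (P (G @^-1` [set u])) * F u)%:E.
Proof.
rewrite unlock.
have -> : (fun w => ((F \o G) w)%:E) =
    (fun w => \sum_u (F u)%:E * (\1_(G @^-1` [set u]) w)%:E)%E.
  apply/funext => w; rewrite (bigD1 (G w))//= big1.
    by rewrite indicE mem_set// mule1 adde0.
  by move=> u uw; rewrite indicE memNset ?mule0// => /= e; rewrite e eqxx in uw.
have ii u : P.-integrable setT (fun w => (F u)%:E * (\1_(G @^-1` [set u]) w)%:E)%E.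
  apply: integrableZl => //; apply: integrable_indic => //.
rewrite integral_sum//= -sumEFin; apply: eq_bigr => u _.
rewrite integralZl//=; last exact: integrable_indic.
by rewrite integral_indic// setIT EFinM fineK ?fin_num_measure// muleC.
Qed.

End FiniteValued.

Section TruncatedMoments.
Context {d : measure_display} {T : measurableType d} {R : realType}.
Variables (P : probability T R) (Y : {RV P >-> R}) (Z : T -> R).
Hypothesis mZ : measurable_fun setT Z.
Hypothesis Y2 : ('E_P[(fun w => Y w ^+ 2)%R] = 1)%E.

Let mY : measurable_fun setT Y.
Proof. exact: measurable_funPT. Qed.

Lemma second_moment_le (e : R) : (forall w, `|Z w| <= `|Y w| + e) -> 0 <= e -> e <= 1 ->
  ('E_P[(fun w => Z w ^+ 2)%R] <= 4%:E)%E.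
Proof.
move=> ZY e0 e1.
apply: (@le_trans _ _ ('E_P[(fun w => 2 * Y w ^+ 2 + 2)%R])%E).
  apply: expectation_le.
  - exact: measurable_funX.
  - apply: measurable_funD => //; apply: measurable_funM => //; exact: measurable_funX.
  - by move=> w; exact: sqr_ge0.
  - by move=> w; rewrite addr_ge0// mulr_ge0// sqr_ge0.
  - apply: aeW => w.
    rewrite -real_normK ?num_real// -[Y w ^+ 2]real_normK ?num_real//.
    apply: (@le_trans _ _ ((`|Y w| + e) ^+ 2)).
      by rewrite lerXn2r// nnegrE ?addr_ge0.
    have : 0 <= (`|Y w| - e) ^+ 2 := sqr_ge0 _.
    have : e ^+ 2 <= 1 by rewrite expr_le1.
    rewrite !expr2; nra.
move: Y2; rewrite unlock => Y2'.
have mY2 : measurable_fun setT (fun w => (Y w ^+ 2)%:E).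
  by apply/measurable_EFinP; exact: measurable_funX.
under eq_integral do rewrite EFinD EFinM.
rewrite ge0_integralD//; first last.
- by apply: emeasurable_funM.
- by move=> w _; rewrite -EFinM lee_fin mulr_ge0// sqr_ge0.
rewrite ge0_integralZl//; first last.
  by move=> w _; rewrite lee_fin sqr_ge0.
rewrite Y2' integral_cst//= probability_setT !mule1 -EFinD lee_fin; lra.
Qed.

(** Since [Y] is centered, the mean of [Z] is that of the error [Z - Y]. *)
Lemma truncated_mean_le (e k s mu : R) : ('E_P[Y] = 0)%E ->
  ('E_P[(fun w => `|Y w| `^ s)%R] <= mu%:E)%E -> 0 <= e -> 0 <= k ->
  (forall w, `|Z w - Y w| <= e + k * `|Y w| `^ s) ->
  (`| 'E_P[Z] | <= (e + k * mu)%:E)%E.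
Proof.
move=> Y1 Ys e0 k0 ZY.
have iY : P.-integrable setT (EFin \o Y).
  apply: (@le_integrable _ _ _ P _ measurableT _ (fun w => (1 + Y w ^+ 2)%:E)).
  - exact/measurable_EFinP.
  - move=> w _ /=; rewrite lee_fin [leRHS]ger0_norm ?addr_ge0 ?sqr_ge0//.
    rewrite -[Y w ^+ 2]real_normK ?num_real//.
    have : 0 <= (`|Y w| - 1) ^+ 2 := sqr_ge0 _.
    by have := normr_ge0 (Y w); rewrite !expr2; nra.
  - apply/integrableP; split.
      apply/measurable_EFinP; apply: measurable_funD => //; exact: measurable_funX.
    under eq_integral do rewrite gee0_abs ?lee_fin ?addr_ge0 ?sqr_ge0// EFinD.
    rewrite ge0_integralD//; first last.
    + by apply/measurable_EFinP; exact: measurable_funX.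
    + by move=> w _; rewrite lee_fin sqr_ge0.
    move: Y2; rewrite unlock => ->; rewrite integral_cst//= probability_setT mule1.
    by rewrite -EFinD ltry.
have mpow : measurable_fun setT (fun w => `|Y w| `^ s).
  apply: (measurableT_comp (measurable_powR s)); exact: measurableT_comp.
have iB : P.-integrable setT (fun w => (e + k * `|Y w| `^ s)%:E).
  apply/integrableP; split.
    apply/measurable_EFinP; apply: measurable_funD => //; exact: measurable_funM.
  under eq_integral do rewrite gee0_abs ?lee_fin ?addr_ge0 ?mulr_ge0 ?powR_ge0// EFinD EFinM.
  rewrite ge0_integralD//; first last.
  + by apply: emeasurable_funM => //; exact/measurable_EFinP.
  + by move=> w _; rewrite -EFinM lee_fin mulr_ge0// powR_ge0.
  rewrite ge0_integralZl//; last exact/measurable_EFinP.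
  rewrite integral_cst//= probability_setT mule1.
  move: Ys; rewrite unlock => Ys.
  apply: (@le_lt_trans _ _ (e%:E + k%:E * mu%:E)%E); last by rewrite -EFinM -EFinD ltry.
  by apply: leeD => //; apply: lee_wpmul2l; rewrite ?lee_fin.
have iD : P.-integrable setT (fun w => (Z w - Y w)%:E).
  apply: le_integrable iB => //.
    by apply/measurable_EFinP; exact: measurable_funB.
  move=> w _ /=; rewrite lee_fin [leRHS]ger0_norm ?ZY//.
  by rewrite addr_ge0// mulr_ge0// powR_ge0.
have -> : ('E_P[Z])%E = (\int[P]_w (Z w - Y w)%:E)%E.
  have -> : (fun w => (Z w - Y w)%:E) = (fun w => (Z w)%:E - (Y w)%:E)%E by [].
  have iZ : P.-integrable setT (EFin \o Z).
    have -> : EFin \o Z = (fun w => (Z w - Y w)%:E + (Y w)%:E)%E.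
      by apply/funext => w /=; rewrite -EFinD subrK.
    exact: integrableD.
  rewrite integralB//.
  by move: Y1; rewrite unlock => ->; rewrite sube0.
apply: le_trans (le_abse_integral _ measurableT _) _.
  by have /integrableP[] := iD.
apply: (@le_trans _ _ (\int[P]_w (e + k * `|Y w| `^ s)%:E)%E).
  apply: ge0_le_integral => //.
  - by apply: measurableT_comp => //; have /integrableP[] := iD.
  - by have /integrableP[] := iB.
  - by move=> w _; rewrite lee_fin.
under eq_integral do rewrite EFinD EFinM.
rewrite ge0_integralD//; first last.
+ by apply: emeasurable_funM => //; exact/measurable_EFinP.
+ by move=> w _; rewrite -EFinM lee_fin mulr_ge0// powR_ge0.
rewrite ge0_integralZl//; last exact/measurable_EFinP.
rewrite integral_cst//= probability_setT mule1 EFinD EFinM.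
move: Ys; rewrite unlock => Ys.
by apply: leeD => //; apply: lee_wpmul2l; rewrite ?lee_fin.
Qed.

End TruncatedMoments.

(** * The law of the truncated matrix *)

Section Rounding.
Variables (R : realType) (a eps : R).
Hypotheses (a0 : 0 < a) (eps0 : 0 < eps).

Let K := Num.trunc (2 * a / eps).

(** Truncation at [a] followed by rounding down to a grid of mesh [eps]: the
    truncated variable takes finitely many values, which makes the law of the
    whole matrix a finite product law. *)
Definition cell (x : R) : option 'I_K.+1 :=
  if `|x| <= a then Some (inord (Num.trunc ((x + a) / eps))) else None.

Definition cell_value (v : option 'I_K.+1) : R :=
  if v is Some t then (val t)%:R * eps - a else 0.

Let truncP (x : R) : `|x| <= a ->
  (Num.trunc ((x + a) / eps))%:R <= (x + a) / eps < (Num.trunc ((x + a) / eps)).+1%:R.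
Proof.
rewrite ler_norml => /andP[xa _]; apply: truncn_itv; apply: divr_ge0; last exact: ltW.
by rewrite -lerBlDr sub0r.
Qed.

Let trunc_lt (x : R) : `|x| <= a -> (Num.trunc ((x + a) / eps) < K.+1)%N.
Proof.
move=> xa; have /andP[h _] := truncP xa; move: xa; rewrite ler_norml => /andP[_ xa].
rewrite truncn_lt_nat; last by apply: le_trans h; exact: ler0n.
apply: (@le_lt_trans _ _ (2 * a / eps)).
  by apply: ler_wpM2r; [rewrite invr_ge0 ltW|rewrite mulr_natl mulr2n lerD2r].
have : 0 <= 2 * a / eps by rewrite divr_ge0 ?mulr_ge0 ?ltW.
by move=> /truncn_itv/andP[].
Qed.

Lemma cell_value_large (x : R) : a < `|x| -> cell_value (cell x) = 0.
Proof. by move=> ax; rewrite /cell leNgt ax. Qed.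

Lemma cell_value_near (x : R) : `|x| <= a ->
  cell_value (cell x) <= x <= cell_value (cell x) + eps.
Proof.
move=> xa; rewrite /cell xa /= inordK ?trunc_lt//.
have := truncP xa; rewrite ler_pdivlMr// ltr_pdivrMr// => /andP[h1].
by rewrite -natr1 [(_ + 1) * _]mulrDl mul1r => h2; apply/andP; split; lra.
Qed.

Lemma cell_value_le v : `|cell_value v| <= a.
Proof.
case: v => [t|]; last by rewrite normr0 ltW.
have tK : (val t)%:R * eps <= 2 * a.
  rewrite -ler_pdivlMr//; have a2 : 0 <= 2 * a / eps by rewrite divr_ge0 ?mulr_ge0 ?ltW.
  have /andP[h _] := truncn_itv a2; apply: le_trans h.
  by rewrite ler_nat -ltnS ltn_ord.
have t0 : 0 <= (val t)%:R * eps by rewrite mulr_ge0// ltW.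
by rewrite /= ler_norml; apply/andP; split; lra.
Qed.

Lemma cell_value_err (x k s : R) : 0 <= k -> (a < `|x| -> `|x| <= k * `|x| `^ s) ->
  `|cell_value (cell x) - x| <= eps + k * `|x| `^ s.
Proof.
move=> k0 large; have [xa|xa] := leP `|x| a.
  have /andP[h1 h2] := cell_value_near xa.
  have : 0 <= k * `|x| `^ s by rewrite mulr_ge0 ?powR_ge0.
  by move=> ?; rewrite ler_norml; apply/andP; split; lra.
rewrite cell_value_large// sub0r normrN; apply: le_trans (large xa) _.
by rewrite lerDr ltW.
Qed.

Lemma cell_value_le_add (x : R) : `|cell_value (cell x)| <= `|x| + eps.
Proof.
have [xa|xa] := leP `|x| a; last first.
  by rewrite cell_value_large// normr0 addr_ge0// ltW.
have /andP[h1 h2] := cell_value_near xa.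
have := ler_norm x; have := ler_norm (- x); rewrite normrN => ? ?.
by rewrite ler_norml; apply/andP; split; lra.
Qed.

Lemma measurable_cell v : measurable (cell @^-1` [set v]).
Proof.
case: v => [t|]; last first.
  have -> : cell @^-1` [set None] = ~` `[- a, a]%classic.
    apply/seteqP; split=> x; rewrite /= /cell in_itv/= -ler_norml.
      by case: ifP => // /negbT/negP.
    by move=> /negP/negbTE ->.
  by apply: measurableC; exact: measurable_itv.
have -> : cell @^-1` [set Some t] = `[- a, a]%classic `&`
    `[(val t)%:R * eps - a, (val t).+1%:R * eps - a[%classic.
  apply/seteqP; split=> x; rewrite /= /cell !in_itv/= -ler_norml.
    case: ifP => // xa [<-]; rewrite /= inordK ?trunc_lt//; split => //.
    by have := truncP xa; rewrite ler_pdivlMr// ltr_pdivrMr// lerBlDr ltrBrDr.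
  move=> [xa]; rewrite lerBlDr ltrBrDr -ler_pdivlMr// -ltr_pdivrMr// => h.
  rewrite xa; congr Some; apply: val_inj; rewrite /= inordK ?trunc_lt//.
  exact: truncn_def.
by apply: measurableI; exact: measurable_itv.
Qed.

End Rounding.

Section SparseModel.
Context {d : measure_display} {T : measurableType d} {R : realType}.
Variables (P : probability T R) (N n : nat).
Variables (X xi : 'I_N -> 'I_n -> {RV P >-> R}) (p : R).
Hypothesis model : sparse_model X xi p.

Lemma bernoulli_probability j k : P (xi j k @^-1` [set 1]) = p%:E.
Proof.
have m1 : measurable (xi j k @^-1` [set 1]) by exact: measurable_funPTI.
rewrite -(xi_mean model j k) -(expectation_indic P m1); congr expectation.
apply/funext => w; rewrite indicE.
have [x0|x1] := xi_01 model j k w; last by rewrite mem_set// x1.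
by rewrite memNset ?x0//= x0 => /esym/eqP; rewrite oner_eq0.
Qed.

Lemma bernoulli_range (j : 'I_N) (k : 'I_n) : 0 <= p <= 1.
Proof.
by rewrite -!lee_fin -(bernoulli_probability j k) measure_ge0 probability_le1//; exact: measurable_funPTI.
Qed.

Lemma sparse_independent (C D : 'I_N * 'I_n -> set R) :
  (forall e, measurable (C e)) -> (forall e, measurable (D e)) ->
  P [set w | forall e, C e (X e.1 e.2 w) /\ D e (xi e.1 e.2 w)] =
  (\prod_e (P (X e.1 e.2 @^-1` C e) * P (xi e.1 e.2 @^-1` D e)))%E.
Proof.
move=> mC mD.
pose B (i : ('I_N * 'I_n) + ('I_N * 'I_n)) := match i with inl e => C e | inr e => D e end.
have mB i : measurable (B i) by case: i.
have := entries_independent model [set: _]%SET mB.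
have -> : \bigcap_(i in [set` [set: _]%SET]) (entries X xi i @^-1` B i) =
    [set w | forall e, C e (X e.1 e.2 w) /\ D e (xi e.1 e.2 w)].
  apply/seteqP; split=> w /= h.
    move=> e; split; first by apply: (h (inl e)); rewrite /= finset.in_setT.
    by apply: (h (inr e)); rewrite /= finset.in_setT.
  by case=> e _; have [] := h e.
move=> ->; rewrite (eq_bigl xpredT) => [|i]; last by rewrite finset.in_setT.
by rewrite big_sumType/= big_split.
Qed.

Lemma pair_independent j k (C D : set R) : measurable C -> measurable D ->
  P ((X j k @^-1` C) `&` (xi j k @^-1` D)) = (P (X j k @^-1` C) * P (xi j k @^-1` D))%E.
Proof.
move=> mC mD.
pose e0 := (j, k).
pose C' (e : 'I_N * 'I_n) : set R := if e == e0 then C else setT.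
pose D' (e : 'I_N * 'I_n) : set R := if e == e0 then D else setT.
have := @sparse_independent C' D'.
have -> : [set w | forall e, C' e (X e.1 e.2 w) /\ D' e (xi e.1 e.2 w)] =
    (X j k @^-1` C) `&` (xi j k @^-1` D).
  apply/seteqP; split=> w /=; first by move=> /(_ e0); rewrite /C' /D' eqxx.
  by move=> [Cw Dw] e; rewrite /C' /D'; case: eqP => [->|].
move=> ->; [|by move=> e; rewrite /C'; case: ifP|by move=> e; rewrite /D'; case: ifP].
rewrite (bigD1 e0)//= /C' /D' eqxx big1 ?mule1//.
by move=> e /negbTE ->; rewrite !preimage_setT !probability_setT mule1.
Qed.

Lemma measure_finite_union_le (I : eqType) (s : seq I) (F : I -> set T) (c : \bar R) :
  (forall e, measurable (F e)) -> (forall e, (P (F e) <= c)%E) -> (0 <= c)%E ->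
  measurable [set w | exists2 e, e \in s & F e w] /\
  (P [set w | exists2 e, e \in s & F e w] <= (size s)%:R%:E * c)%E.
Proof.
move=> mF Fc c0; elim: s => [|e s [IHm IHs]].
  have -> : [set w | exists2 e, e \in [::] & F e w] = set0.
    by apply/seteqP; split=> w //= [e]; rewrite in_nil.
  by rewrite measure0 mul0e.
have -> : [set w | exists2 e', e' \in e :: s & F e' w] =
    F e `|` [set w | exists2 e', e' \in s & F e' w].
  apply/seteqP; split=> w /=.
    move=> [e']; rewrite inE => /predU1P[->|e's] Fe; [by left|by right; exists e'].
  move=> [Fe|[e' e's Fe]]; first by exists e; rewrite ?mem_head.
  by exists e' => //; rewrite inE e's orbT.
split; first exact: measurableU.
apply: le_trans (measureU2 _ _ _) _ => //.
have -> : ((size (e :: s))%:R%:E * c)%E = (c + (size s)%:R%:E * c)%E.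
  rewrite /= -[X in (X%:E * _)%E]natr1 addrC EFinD ge0_muleDl ?mul1e ?lee_fin//.
by apply: leeD; [exact: Fc|exact: IHs].
Qed.

Definition large_entry (a : R) : set T :=
  [set w | exists2 e, e \in enum {: 'I_N * 'I_n} &
    ((X e.1 e.2 @^-1` [set x | a < `|x|]) `&` (xi e.1 e.2 @^-1` [set 1])) w].

Lemma probability_large_entry (a : R) (j1 : 'I_N) (k1 : 'I_n) : (n <= N)%N ->
  measurable (large_entry a) /\
  (P (large_entry a) <= (N%:R ^+ 2 * p)%:E * P [set w | (a < `|X j1 k1 w|)%R])%E.
Proof.
move=> nN; have /andP[p0 p1] := bernoulli_range j1 k1.
pose A : set R := [set x | a < `|x|].
have mA : measurable A.
  have -> : A = Num.norm @^-1` `]a, +oo[%classic.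
    by apply/seteqP; split=> x; rewrite /= in_itv/= andbT.
  by rewrite -[X in measurable X]setTI; apply: normr_measurable.
have XA : [set w | (a < `|X j1 k1 w|)%R] = X j1 k1 @^-1` A by [].
have F0 (e : 'I_N * 'I_n) :
    (P ((X e.1 e.2 @^-1` A) `&` (xi e.1 e.2 @^-1` [set 1%R])) <=
     p%:E * P (X j1 k1 @^-1` A))%E.
  rewrite pair_independent// bernoulli_probability muleC.
  by rewrite (X_identically_distributed model _ _ j1 k1 mA).
have c0 : (0 <= p%:E * P (X j1 k1 @^-1` A))%E by rewrite mule_ge0 ?lee_fin.
have [|mL PL] := measure_finite_union_le (enum {: 'I_N * 'I_n}) _ F0 c0.
  by move=> e; apply: measurableI; exact: measurable_funPTI.
split=> //; apply: le_trans PL _; rewrite XA.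
rewrite -cardE card_prod !card_ord EFinM -muleA; apply: lee_wpmul2r => //.
by rewrite lee_fin -natrX ler_nat expnS expn1 leq_mul2l nN orbT.
Qed.

Section Law.
Variables (V : finType) (g : R -> V).
Hypothesis mg : forall v, measurable (g @^-1` [set v]).

(** Everything that the truncated matrix depends on; it takes finitely many
    values. *)
Definition configuration (w : T) : {ffun 'I_N * 'I_n -> bool * V} :=
  [ffun e => (xi e.1 e.2 w == 1, g (X e.1 e.2 w))].

Definition cell_law (e : 'I_N * 'I_n) (v : V) : R :=
  fine (P ((g \o X e.1 e.2) @^-1` [set v])).

Definition entry_law (e : 'I_N * 'I_n) (x : bool * V) : R :=
  (if x.1 then p else 1 - p) * cell_law e x.2.

Lemma measurable_cell_rv e v : measurable ((g \o X e.1 e.2) @^-1` [set v]).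
Proof. by rewrite comp_preimage; exact: measurable_funPTI. Qed.

Lemma cell_law_ge0 e v : 0 <= cell_law e v.
Proof. exact: fine_ge0. Qed.

Lemma cell_law_sum1 e : \sum_v cell_law e v = 1.
Proof.
have := probability_finite_preimage P (measurable_cell_rv e) xpredT.
have -> : [set w | xpredT ((g \o X e.1 e.2) w)] = setT by apply/seteqP.
rewrite probability_setT => h; apply: EFin_inj; rewrite h -sumEFin.
by apply: eq_bigr => v _; rewrite fineK// fin_num_measure//; exact: measurable_cell_rv.
Qed.

Lemma entry_law_ge0 e x : 0 <= entry_law e x.
Proof.
have /andP[p0 p1] := bernoulli_range e.1 e.2.
by rewrite mulr_ge0 ?cell_law_ge0//; case: ifP => // _; rewrite subr_ge0.
Qed.

Lemma entry_law_sum e (F : bool -> V -> R) :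
  \sum_x entry_law e x * F x.1 x.2 =
  p * (\sum_v cell_law e v * F true v) + (1 - p) * (\sum_v cell_law e v * F false v).
Proof.
rewrite sum_pair big_bool/= !mulr_sumr.
by congr (_ + _); apply: eq_bigr => v _; rewrite mulrA.
Qed.

Lemma entry_law_sum1 e : \sum_x entry_law e x = 1.
Proof.
have := entry_law_sum e (fun _ _ => 1); under eq_bigr do rewrite mulr1.
by move=> ->; under eq_bigr do rewrite mulr1; rewrite cell_law_sum1; ring.
Qed.

Lemma bernoulli_eq1 j k (b : bool) :
  P (xi j k @^-1` [set x | (x == 1) = b]) = (if b then p else 1 - p)%:E.
Proof.
have m1 : measurable (xi j k @^-1` [set 1]) by exact: measurable_funPTI.
have e1 : [set x : R | (x == 1) = true] = [set 1].
  by apply/seteqP; split=> x /= /eqP.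
case: b; first by rewrite e1 bernoulli_probability.
have -> : [set x : R | (x == 1) = false] = ~` [set 1].
  by apply/seteqP; split=> x /= => [/eqP|/eqP/negbTE].
by rewrite -preimage_setC probability_setC// bernoulli_probability.
Qed.

Lemma configuration_law c :
  measurable (configuration @^-1` [set c]) /\
  P (configuration @^-1` [set c]) = (product_law entry_law c)%:E.
Proof.
pose C (e : 'I_N * 'I_n) := g @^-1` [set (c e).2].
pose D (e : 'I_N * 'I_n) := [set x : R | (x == 1) = (c e).1].
have mC e : measurable (C e) by exact: mg.
have mD e : measurable (D e).
  have e1 : [set x : R | (x == 1) = true] = [set 1].
    by apply/seteqP; split=> x /= /eqP.
  rewrite /D; case: (c e).1; first by rewrite e1.
  have -> : [set x : R | (x == 1) = false] = ~` [set 1].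
    by apply/seteqP; split=> x /= => [/eqP|/eqP/negbTE].
  exact: measurableC.
have cE : configuration @^-1` [set c] =
    [set w | forall e, C e (X e.1 e.2 w) /\ D e (xi e.1 e.2 w)].
  apply/seteqP; split=> w /=.
    by move=> /= wc e; rewrite /C /D/= -wc ffunE.
  move=> h; apply/ffunP => e; rewrite ffunE.
  by have [/= -> ->] := h e; rewrite -surjective_pairing.
split.
  have -> : configuration @^-1` [set c] =
      \bigcap_(e in [set: 'I_N * 'I_n]) ((X e.1 e.2 @^-1` C e) `&` (xi e.1 e.2 @^-1` D e)).
    by rewrite cE; apply/seteqP; split=> w /= h e; [move=> _; exact: h|exact: h].
  apply: fin_bigcap_measurable; first exact: finite_finset.
  by move=> e _; apply: measurableI; exact: measurable_funPTI.
rewrite cE sparse_independent// -prodEFin; apply: eq_bigr => e _.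
rewrite bernoulli_eq1 /entry_law EFinM muleC; congr (_ * _)%E.
by rewrite /cell_law fineK// fin_num_measure//; exact: measurable_cell_rv.
Qed.

Lemma cell_law_mean e (F : V -> R) :
  (\sum_v cell_law e v * F v)%:E = ('E_P[F \o (g \o X e.1 e.2)])%E.
Proof. by rewrite expectation_finite_valued//; exact: measurable_cell_rv. Qed.

End Law.
End SparseModel.

(** * The tail of the largest singular value *)

Section SparseTail.
Context {d : measure_display} {T : measurableType d} {R : realType}.
Variables (P : probability T R) (N n : nat).
Variables (X xi : 'I_N -> 'I_n -> {RV P >-> R}) (p : R).
Hypothesis model : sparse_model X xi p.

Section Truncation.
Variables (a eps k s mu : R).
Hypotheses (a0 : 0 < a) (eps0 : 0 < eps) (eps1 : eps <= 1) (k0 : 0 <= k).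
Hypothesis large : forall x : R, a < `|x| -> `|x| <= k * `|x| `^ s.
Hypothesis Xs : forall i j, ('E_P[(fun w => `|X i j w| `^ s)%R] <= mu%:E)%E.

Let V := option 'I_(Num.trunc (2 * a / eps)).+1.
Let g : R -> V := @cell R a eps.
Let val : V -> R := @cell_value R a eps.

Let mg v : measurable (g @^-1` [set v]).
Proof. exact: measurable_cell. Qed.

Let law := @cell_law _ _ _ P N n X V g.

Let mval e : measurable_fun setT (val \o (g \o X e.1 e.2)).
Proof. by apply: measurable_finite_comp => v; exact: measurable_cell_rv. Qed.

Lemma cell_mean_le e : `|\sum_v law e v * val v| <= eps + k * mu.
Proof.
rewrite -lee_fin -abse_EFin cell_law_mean//.
apply: (truncated_mean_le (mval e) (X_second_moment model e.1 e.2) _ (Xs e.1 e.2)) => //.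
- exact: X_mean0 model _ _.
- exact: ltW.
- by move=> w; apply: cell_value_err => //; exact: large.
Qed.

Lemma cell_second_moment_le e : \sum_v law e v * val v ^+ 2 <= 4.
Proof.
rewrite -lee_fin (cell_law_mean X mg e (fun v => val v ^+ 2)).
apply: (second_moment_le (mval e) (X_second_moment model e.1 e.2) _ (ltW eps0) eps1).
by move=> w; exact: cell_value_le_add.
Qed.

Definition entry_mean (e : 'I_N * 'I_n) : R := p * \sum_v law e v * val v.

Definition entry_value (b : R) (e : 'I_N * 'I_n) (x : bool * V) : R :=
  (x.1%:R * val x.2 - entry_mean e) / b.

Lemma entry_mean_le e : `|entry_mean e| <= p * (eps + k * mu).
Proof.
have /andP[p0 _] := bernoulli_range model e.1 e.2.
by rewrite normrM ger0_norm//; apply: ler_wpM2l => //; exact: cell_mean_le.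
Qed.

Lemma entry_mean_le_trunc e : `|entry_mean e| <= a.
Proof.
have /andP[p0 p1] := bernoulli_range model e.1 e.2.
rewrite normrM ger0_norm//; apply: le_trans (ler_piMl (normr_ge0 _) p1) _.
apply: le_trans (ler_norm_sum _ _ _) _.
rewrite -[leRHS]mul1r -[X in _ <= X * _](cell_law_sum1 X mg e) mulr_suml.
apply: ler_sum => v _.
by rewrite normrM ger0_norm ?cell_law_ge0//; apply: ler_wpM2l; [exact: cell_law_ge0|exact: cell_value_le].
Qed.

Let elaw := @entry_law _ _ _ P N n X p V g.

Lemma entry_value_le b e x : 2 * a <= b -> `|entry_value b e x| <= 1.
Proof.
move=> ab; have b0 : 0 < b by apply: lt_le_trans ab; rewrite mulr_gt0.
rewrite normrM normfV (gtr0_norm b0) ler_pdivrMr// mul1r.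
apply: le_trans (ler_normB _ _) _; apply: le_trans ab.
rewrite [leRHS]mulr_natl [leRHS]mulr2n; apply: lerD; last exact: entry_mean_le_trunc.
by case: x.1; rewrite ?mul1r ?mul0r ?normr0 ?(ltW a0)//; exact: cell_value_le.
Qed.

Lemma entry_value_mean0 b e : moment elaw (entry_value b) e 1 = 0.
Proof.
rewrite /moment; under eq_bigr do rewrite expr1 /entry_value mulrA.
rewrite -mulr_suml (entry_law_sum X p g e (fun b v => b%:R * val v - entry_mean e)).
have -> : \sum_v cell_law X g e v * (true%:R * val v - entry_mean e) =
    \sum_v law e v * val v - entry_mean e.
  under eq_bigr do rewrite mul1r mulrBr.
  by rewrite big_split/= sumrN -mulr_suml cell_law_sum1// mul1r.
have -> : \sum_v cell_law X g e v * (false%:R * val v - entry_mean e) = - entry_mean e.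
  under eq_bigr do rewrite mul0r sub0r.
  by rewrite -mulr_suml cell_law_sum1// mul1r.
by rewrite /entry_mean; ring.
Qed.

Lemma entry_value_moment2 b e : moment elaw (entry_value b) e 2 <= 4 * p / b ^+ 2.
Proof.
have /andP[p0 p1] := bernoulli_range model e.1 e.2.
rewrite /moment; under eq_bigr do rewrite /entry_value expr_div_n mulrA.
rewrite -mulr_suml (entry_law_sum X p g e (fun b v => (b%:R * val v - entry_mean e) ^+ 2)).
apply: ler_wpM2r; first by rewrite invr_ge0 sqr_ge0.
set m := entry_mean e; set S2 := \sum_v law e v * val v ^+ 2.
have -> : \sum_v cell_law X g e v * (true%:R * val v - m) ^+ 2 =
    S2 - 2 * m * (\sum_v law e v * val v) + m ^+ 2.
  have -> : m ^+ 2 = \sum_v law e v * m ^+ 2.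
    by rewrite -mulr_suml cell_law_sum1// mul1r.
  rewrite mulr_sumr.
  rewrite -sumrB -big_split/=; apply: eq_bigr => v _.
  by rewrite mul1r -/(law e v); ring.
have -> : \sum_v cell_law X g e v * (false%:R * val v - m) ^+ 2 = m ^+ 2.
  under eq_bigr do rewrite mul0r sub0r sqrrN.
  by rewrite -mulr_suml cell_law_sum1// mul1r.
have -> : p * (S2 - 2 * m * \sum_v law e v * val v + m ^+ 2) + (1 - p) * m ^+ 2 =
    p * S2 - m ^+ 2.
  have mE : m = p * \sum_v law e v * val v by [].
  transitivity (p * S2 - 2 * m * (p * \sum_v law e v * val v) + m ^+ 2); first by ring.
  by rewrite -mE; ring.
have := cell_second_moment_le e; rewrite -/S2 => S24.
have := sqr_ge0 m; have := ler_wpM2l p0 S24; lra.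
Qed.

(** The remainder collects the rounding error and the mean removed from the
    truncated entry. *)
Lemma sparse_matrix_decomposition b w : 0 < b -> ~ large_entry X xi a w ->
  exists2 E : 'M[R]_(N, n),
    (forall j k', `|E j k'| <= eps + p * (eps + k * mu)) &
    sparse_matrix X xi w =
      b *: random_matrix (entry_value b) (configuration X xi g w) + E.
Proof.
move=> b0 Lw.
pose Z := random_matrix (entry_value b) (configuration X xi g w).
exists (sparse_matrix X xi w - b *: Z); last by rewrite addrC subrK.
move=> j k'; pose e := (j, k').
have -> : (sparse_matrix X xi w - b *: Z) j k' =
    (xi j k' w * X j k' w - (xi j k' w == 1)%:R * val (g (X j k' w))) + entry_mean e.
  rewrite !mxE ffunE/= /entry_value/= [b * _]mulrC divfK ?lt0r_neq0//.
  by rewrite opprB addrA addrAC.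
apply: le_trans (ler_normD _ _) _; apply: lerD; last exact: entry_mean_le.
have [x0|x1] := xi_01 model j k' w.
  by rewrite x0 eq_sym oner_eq0 !mul0r subrr normr0 ltW.
rewrite x1 eqxx !mul1r.
have [xa|xa] := leP `|X j k' w| a.
  have /andP[h1 h2] : val (g (X j k' w)) <= X j k' w <= val (g (X j k' w)) + eps.
    by have := cell_value_near a0 eps0 xa.
  by rewrite ler_norml; apply/andP; split; lra.
by case: Lw; exists e; rewrite ?mem_enum.
Qed.

(** Either a nonzero entry exceeds [a], or the matrix is [b Z + E] with small [E],
    and then a singular value larger than [t] forces a large trace power of [Z]. *)
Lemma sparse_tail b tau t i (j1 : 'I_N) (k1 : 'I_n) :
  (n <= N)%N -> 0 < p -> 0 <= mu -> 2 * a <= b ->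
  4 * p / b ^+ 2 <= 1 -> 4 * p / b ^+ 2 * N%:R <= (2 ^ i.+1)%:R -> 0 < tau ->
  b * tau + N%:R * (eps + p * (eps + k * mu)) < t ->
  (P [set w | (t <= largest_singular_value (sparse_matrix X xi w))%R] <=
   ((tau ^+ (2 * 2 ^ i.+1))^-1 * ((4 * p / b ^+ 2)^-1 *
      (walk_const R * (2 ^ i.+1)%:R) ^+ (2 ^ i.+1)))%:E +
   (N%:R ^+ 2 * p)%:E * P [set w | (a < `|X j1 k1 w|)%R])%E.
Proof.
move=> nN p0 mu0 ab q1 qN tau0 tE.
have b0 : 0 < b by apply: lt_le_trans ab; rewrite mulr_gt0.
have n0 : (0 < n)%N by apply: leq_ltn_trans (ltn_ord k1).
set q := 4 * p / b ^+ 2.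
have q0 : 0 < q by rewrite divr_gt0 ?exprn_gt0 ?mulr_gt0.
set M := (2 ^ i.+1)%N.
have M0 : M.-1.+1 = M by rewrite prednK// expn_gt0.
pose tr c := \tr (((random_matrix (entry_value b) c)^T *m
  random_matrix (entry_value b) c) ^+ M).
have tt0 : 0 < t.
  apply: le_lt_trans tE; rewrite addr_ge0 ?mulr_ge0 ?(ltW b0) ?(ltW tau0)//.
  by rewrite !addr_ge0 ?mulr_ge0 ?addr_ge0 ?mulr_ge0 ?(ltW eps0) ?(ltW p0).
pose bad (c : {ffun 'I_N * 'I_n -> bool * V}) := tau ^+ (2 * M) <= tr c.
have [mL PL] := probability_large_entry model a j1 k1 nN.
have mc := fun c => (configuration_law model mg c).1.
have mbad : measurable [set w | bad (configuration X xi g w)].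
  exact: measurable_finite_preimage.
have Pbad : (P [set w | bad (configuration X xi g w)] <=
    ((tau ^+ (2 * M))^-1 * (q^-1 * (walk_const R * M%:R) ^+ M))%:E)%E.
  rewrite (probability_finite_preimage P mc bad).
  rewrite (eq_bigr (fun c => (product_law elaw c)%:E)) => [|c _]; last first.
    by have [] := configuration_law model mg c.
  rewrite sumEFin lee_fin.
  have := @tr_gram_tail R N n _ elaw (entry_value b) q (tau ^+ (2 * M)) M.-1.
  rewrite M0; apply => //.
  - by move=> e x; apply: (entry_law_ge0 model).
  - by move=> e; apply: entry_law_sum1.
  - by move=> e x; apply: entry_value_le.
  - by move=> e; exact: entry_value_mean0.
  - by move=> e; exact: entry_value_moment2.
  - by rewrite exprn_gt0.
  - by move=> c; exact: gram_pow_tr_ge0.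
apply: (@le_trans _ _ (P ([set w | bad (configuration X xi g w)] `|` large_entry X xi a))).
  apply: le_measure; rewrite ?inE.
  - apply: measurable_le_largest_singular_value => // j k'.
    have -> : (fun w => sparse_matrix X xi w j k') = (fun w => xi j k' w * X j k' w).
      by apply/funext => w; rewrite mxE.
    by apply: measurable_funM; exact: measurable_funPT.
  - exact: measurableU.
  move=> w /(le_largest_singular_value _ nN tt0)[s' Ms ts].
  apply: contrapT => /not_orP[/negP nb nL].
  have [E El ME] := sparse_matrix_decomposition b0 nL.
  rewrite ME in Ms.
  have e0 : 0 <= eps + p * (eps + k * mu).
    by rewrite addr_ge0 ?mulr_ge0 ?addr_ge0 ?mulr_ge0 ?(ltW eps0) ?(ltW p0).
  have trE : tr (configuration X xi g w) <= tau ^+ (2 * M).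
    by apply: ltW; rewrite ltNge.
  have := singular_value_le nN (ltW b0) e0 (ltW tau0) El trE Ms.
  by rewrite leNgt (lt_le_trans tE ts).
apply: le_trans (measureU2 _ mbad mL) _.
exact: leeD.
Qed.

End Truncation.
End SparseTail.

(** * Choice of the parameters *)

Section Constants.
Variables (R : realType) (delta mu B Q A : R).
Hypotheses (hdelta : 0 < delta) (hmu : 0 < mu) (hB : 0 < B) (hQ : 1 <= Q) (hA : 0 < A).

Let kappa := varkappa delta.
Let s := 4 + delta.
Let l2 : R := ln 2.

Let l2_gt0 : 0 < l2.
Proof. by rewrite ln_gt0// ltr1n. Qed.

Let s_gt0 : 0 < s. Proof. by rewrite addr_gt0. Qed.

Let kappa_gt0 : 0 < kappa.
Proof. by rewrite divr_gt0// mulr_gt0. Qed.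

Lemma varkappa_exponent : (1 / 2 - kappa) * s = 2.
Proof.
have s0 : 4 + delta != 0 by rewrite gt_eqF.
by rewrite /kappa /varkappa /s; field.
Qed.

Let c1 : R := A / B `^ kappa.

Let Bk_gt0 : 0 < B `^ kappa. Proof. exact: powR_gt0. Qed.

Let c1_gt0 : 0 < c1. Proof. exact: divr_gt0. Qed.

Definition truncation_level (x l : R) : R := A * x `^ (1 / 2 - kappa) * l.

(** The growth condition on [x = N p] is what makes truncation compatible with a
    spectral norm of order [sqrt x]: with [l = ln N] the truncation level is at
    most [c1 sqrt (x / l)]. *)
Lemma truncation_level_le (x l : R) : 0 < x -> 0 < l ->
  B * l `^ (3 / (2 * kappa)) <= x ->
  truncation_level x l * Num.sqrt l <= c1 * Num.sqrt x.
Proof.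
move=> x0 l0 lx.
have u_ge : B `^ kappa * (l * Num.sqrt l) <= x `^ kappa.
  have -> : B `^ kappa * (l * Num.sqrt l) = (B * l `^ (3 / (2 * kappa))) `^ kappa.
    rewrite powRM ?powR_ge0 ?(ltW hB)// -powRrM.
    have -> : 3 / (2 * kappa) * kappa = 1 + 2^-1.
      by have k0 := gt_eqF kappa_gt0; field; rewrite k0.
    by rewrite powRD ?lt0r_neq0 ?implybT// powRr1 ?(ltW l0)// powR12_sqrt ?(ltW l0).
  apply: ge0_ler_powR => //; rewrite ?nnegrE; try exact: ltW.
  by rewrite mulr_ge0 ?powR_ge0// ltW.
have xu : x `^ (1 / 2 - kappa) * x `^ kappa = Num.sqrt x.
  rewrite -powRD ?lt0r_neq0 ?implybT//.
  have -> : 1 / 2 - kappa + kappa = 2^-1 by rewrite subrK div1r.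
  by rewrite powR12_sqrt// ltW.
rewrite /c1 [leRHS]mulrAC ler_pdivlMr// -xu /truncation_level.
have -> : A * x `^ (1 / 2 - kappa) * l * Num.sqrt l * B `^ kappa =
  (A * x `^ (1 / 2 - kappa)) * (B `^ kappa * (l * Num.sqrt l)) by ring.
rewrite [leRHS]mulrA; apply: ler_wpM2l => //.
by rewrite mulr_ge0 ?powR_ge0// ltW.
Qed.

Lemma truncation_level_gt0 (x l : R) : 0 < x -> 0 < l -> 0 < truncation_level x l.
Proof. by move=> x0 l0; rewrite !mulr_gt0// powR_gt0. Qed.

(** The exponent [varkappa] is chosen so that the power [4 + delta] of the
    truncation level is of order [x ^ 2]: this makes the mean of the discarded
    part of an entry negligible. *)
Lemma truncation_level_pow (x l : R) : 0 < x -> 0 < l ->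
  truncation_level x l `^ s = A `^ s * x ^+ 2 * l `^ s.
Proof.
move=> x0 l0.
rewrite /truncation_level !powRM ?mulr_ge0 ?powR_ge0 ?(ltW hA) ?(ltW l0)//.
by rewrite -powRrM varkappa_exponent powR_mulrn// ltW.
Qed.

Lemma large_le_moment (a y : R) : 0 < a -> a < y -> y <= a / a `^ s * y `^ s.
Proof.
move=> a0 ay; have y0 : 0 < y := lt_trans a0 ay.
rewrite [leRHS]mulrAC ler_pdivlMr ?powR_gt0//.
have E (z : R) : 0 < z -> z `^ s = z * z `^ (3 + delta).
  move=> z0; rewrite -{2}(powRr1 (ltW z0)) -powRD ?lt0r_neq0 ?implybT//.
  by congr (_ `^ _); rewrite /s; ring.
rewrite !E// mulrCA; apply: ler_wpM2l; first exact: ltW.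
apply: ler_wpM2l; first exact: ltW.
by apply: ge0_ler_powR; rewrite ?nnegrE ?(ltW a0) ?(ltW y0) ?(ltW ay)// ltW// addr_gt0.
Qed.

Let L : R := 4 + 4 * c1 ^+ 2.
Let L_ge4 : 4 <= L. Proof. by rewrite lerDl mulr_ge0// sqr_ge0. Qed.
Let L_gt0 : 0 < L. Proof. exact: lt_le_trans L_ge4. Qed.

Let C1 : R := 2 * (Q + 1) + 2 / l2.
Let C1_gt0 : 0 < C1.
Proof.
have Q1 : 0 < Q + 1 by rewrite addr_gt0// (lt_le_trans _ hQ).
by apply: addr_gt0; [exact: mulr_gt0|exact: divr_gt0].
Qed.

Let W : R := expR 1 * walk_const R * C1.
Let W_gt0 : 0 < W.
Proof. by rewrite !mulr_gt0 ?expR_gt0 ?walk_const_gt0. Qed.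

(** The order [M = 2 ^ i.+1] of the trace must be at least [(Q + 1) l] for
    [exp (- M)] to beat [N ^ (- Q)], and only a multiple of [l] because the trace
    bound grows like the [M]-th power of [M]. *)
Lemma trace_power_exists (l : R) : l2 <= l ->
  exists i, (Q + 1) * l <= (2 ^ i.+1)%:R <= C1 * l.
Proof.
move=> l2l; have l0 : 0 < l := lt_le_trans l2_gt0 l2l.
have Q0 : 0 <= (Q + 1) * l by rewrite mulr_ge0 ?addr_ge0 ?(ltW l0)// (le_trans _ hQ).
have /andP[t1 t2] := truncn_itv Q0.
have [i /andP[i1 i2]] := unstable.leq_ltn_expn (Num.trunc ((Q + 1) * l)).
exists i; apply/andP; split.
  by apply/ltW/(lt_le_trans t2); rewrite ler_nat ltnW.
apply: (@le_trans _ _ (2 * ((Q + 1) * l + 1))).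
  rewrite expnS natrM; apply: ler_wpM2l => //.
  apply: (@le_trans _ _ (Num.trunc ((Q + 1) * l)).+1%:R); first by rewrite ler_nat.
  by rewrite -natr1 lerD2r.
have l_large : 2 <= 2 / l2 * l.
  by rewrite [leRHS]mulrAC ler_pdivlMr//; apply: ler_wpM2l.
rewrite /C1 [leRHS]mulrDl; apply: le_trans (lerD (lexx _) l_large).
by rewrite mulrDr mulr1 mulrA.
Qed.

Let x0 : R := B * l2 `^ (3 / (2 * kappa)).
Let K2 : R := mu * (c1 / Num.sqrt l2) / (A `^ s * l2 `^ s * x0).

(** The first term comes from the centered matrix, the other two from the
    rounding error and the mean of the truncated entries; the last summand makes
    the inequality strict. *)
Definition norm_const : R := Num.sqrt (L * W) + (2 + K2) + 1.
Definition tail_const : R := L / (4 * l2).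

Lemma parameters_exist (N : nat) (p : R) : (2 <= N)%N -> p <= 1 ->
  B * (ln (N%:R : R)) `^ (3 / (2 * kappa)) <= N%:R * p ->
  let l := ln (N%:R : R) in let x := N%:R * p in
  let a := truncation_level x l in
  [/\ 0 < p, 0 < a & exists b tau eps i,
   [/\ 2 * a <= b, 4 * p / b ^+ 2 <= 1,
       4 * p / b ^+ 2 * N%:R <= (2 ^ i.+1)%:R & 0 < tau] /\
   [/\ 0 < eps, eps <= 1,
       b * tau + N%:R * (eps + p * (eps + a / a `^ s * mu)) < norm_const * Num.sqrt x &
       (tau ^+ (2 * 2 ^ i.+1))^-1 * ((4 * p / b ^+ 2)^-1 *
          (walk_const R * (2 ^ i.+1)%:R) ^+ (2 ^ i.+1)) <= tail_const * N%:R `^ (- Q)]].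
Proof.
move=> N2 p1 lx l x a.
have N0 : 0 < N%:R :> R by rewrite ltr0n (leq_trans _ N2).
have l2l : l2 <= l by rewrite ler_ln ?posrE// ler_nat.
have l0 : 0 < l := lt_le_trans l2_gt0 l2l.
have x00 : 0 < x0 by rewrite mulr_gt0// powR_gt0.
have x0x : x0 <= x.
  apply: le_trans lx; apply: ler_wpM2l; first exact: ltW.
  by apply: ge0_ler_powR; rewrite ?nnegrE ?(ltW l0) ?(ltW l2_gt0)// divr_ge0// mulr_ge0// ltW.
have xp : 0 < x := lt_le_trans x00 x0x.
have p0 : 0 < p by move: xp; rewrite pmulr_rgt0.
have a0 : 0 < a := truncation_level_gt0 xp l0.
split=> //.
have al : a * Num.sqrt l <= c1 * Num.sqrt x := truncation_level_le xp l0 lx.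
have as_eq : a `^ s = A `^ s * x ^+ 2 * l `^ s := truncation_level_pow xp l0.
clearbody a.
have [i /andP[M1 M2]] := trace_power_exists l2l.
set M := (2 ^ i.+1)%N in M1 M2 *.
(* With [b ^ 2 = L x / l] the rescaled entries are bounded by [1] and their
   variances times [N] by [l], which is below the order [M] of the trace. Then
   [W l] exceeds [walk_const R * M] by a factor [e], so that each of the [M]
   factors of the tail bound is at most [1 / e]. *)
pose b := Num.sqrt (L * x / l); pose tau := Num.sqrt (W * l).
pose eps := Num.sqrt (p / N%:R).
have b2 : b ^+ 2 = L * x / l by rewrite sqr_sqrtr// divr_ge0 ?mulr_ge0 ?ltW.
have q_eq : 4 * p / b ^+ 2 = 4 / L * (l / N%:R).
  rewrite b2 /x; field.
  by rewrite !gt_eqF.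
have q_l : 4 / L * l <= l.
  by rewrite ler_piMl ?(ltW l0)// ler_pdivrMr// mul1r.
have lN : l <= N%:R.
  have -> : l = ln (1 + (N%:R - 1)) by rewrite addrCA subrr addr0.
  apply: le_trans (le_ln1Dx _) _; first by rewrite ltrBrDr addNr.
  by rewrite lerBlDr lerDl.
have Mpos : 0 < M%:R :> R by rewrite ltr0n expn_gt0.
exists b, tau, eps, i; split; split.
- have b0 : 0 <= b by exact: sqrtr_ge0.
  have a20 : 0 <= 2 * a by rewrite mulr_ge0// ltW.
  suff : (2 * a) ^+ 2 <= b ^+ 2 by rewrite ler_pXn2r.
  rewrite b2.
  rewrite ler_pdivlMr// exprMn -mulrA.
  have -> : a ^+ 2 * l = (a * Num.sqrt l) ^+ 2 by rewrite exprMn sqr_sqrtr// ltW.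
  have : (a * Num.sqrt l) ^+ 2 <= (c1 * Num.sqrt x) ^+ 2.
    by apply: lerXn2r al; rewrite nnegrE mulr_ge0 ?sqrtr_ge0 ?ltW.
  rewrite [leRHS]exprMn sqr_sqrtr ?(ltW xp)// => h.
  have -> : (2 : R) ^+ 2 = 4 by ring.
  rewrite /L [leRHS]mulrDl -[4 * _ * x]mulrA; apply: le_trans (ler_wpM2l _ h) _ => //.
  by rewrite lerDr mulr_ge0// ltW.
- rewrite q_eq mulrA ler_pdivrMr// mul1r; exact: le_trans q_l lN.
- have -> : 4 * p / b ^+ 2 * N%:R = 4 / L * l.
    by rewrite q_eq -[LHS]mulrA divfK ?lt0r_neq0.
  apply: le_trans q_l _.
  apply: le_trans M1; rewrite mulrDl mul1r lerDr mulr_ge0 ?(ltW l0)//.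
  exact: le_trans hQ.
- by rewrite sqrtr_gt0 mulr_gt0.
- by rewrite sqrtr_gt0 divr_gt0.
- have pN : p / N%:R <= 1.
    by rewrite ler_pdivrMr// mul1r (le_trans p1)// ler1n (leq_trans _ N2).
  by rewrite -[leRHS]sqrtr1 ler_sqrt.
- have bt : b * tau = Num.sqrt (L * W) * Num.sqrt x.
    have Lx0 : 0 <= L * x / l.
      by apply: divr_ge0 (ltW l0); exact: mulr_ge0 (ltW L_gt0) (ltW xp).
    rewrite -(sqrtrM _ Lx0) -(sqrtrM _ (mulr_ge0 (ltW L_gt0) (ltW W_gt0))).
    by congr Num.sqrt; field; rewrite gt_eqF.
  have Ne : N%:R * eps = Num.sqrt x.
    have Nsq : N%:R = Num.sqrt (N%:R ^+ 2) :> R by rewrite sqrtr_sqr ger0_norm// ltW.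
    rewrite [X in X * _]Nsq -sqrtrM ?sqr_ge0//.
    by congr Num.sqrt; rewrite /x; field; rewrite gt_eqF.
  have sx : 0 < Num.sqrt x by rewrite sqrtr_gt0.
  have sl : 0 < Num.sqrt l by rewrite sqrtr_gt0.
  have sl2 : 0 < Num.sqrt l2 by rewrite sqrtr_gt0.
  have Ale : a <= c1 / Num.sqrt l2 * Num.sqrt x.
    rewrite [leRHS]mulrAC ler_pdivlMr//; apply: le_trans al.
    by apply: ler_wpM2l; [exact: ltW|rewrite ler_sqrt// ltW].
  have D0 : 0 < A `^ s * l2 `^ s * x0 by rewrite !mulr_gt0// powR_gt0.
  have as_ge : A `^ s * l2 `^ s * x0 * x <= a `^ s.
    rewrite as_eq expr2.
    have -> : A `^ s * (x * x) * l `^ s = A `^ s * (l `^ s * (x * x)) by ring.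
    rewrite [leLHS](_ : _ = A `^ s * (l2 `^ s * (x0 * x))); last by ring.
    apply: ler_wpM2l; first exact: powR_ge0.
    apply: ler_pM.
    + exact: powR_ge0.
    + exact: mulr_ge0 (ltW x00) (ltW xp).
    + apply: ge0_ler_powR l2l; [exact: ltW s_gt0| |].
        by rewrite nnegrE; exact: ltW l2_gt0.
      by rewrite nnegrE; exact: ltW l0.
    + by apply: ler_wpM2r => //; exact: ltW.
  have as0 : 0 < a `^ s by exact: powR_gt0.
  have tail : x * (a / a `^ s * mu) <= K2 * Num.sqrt x.
    rewrite mulrA mulrCA mulrA [X in X <= _](_ : _ = (x * a * mu) / a `^ s); last by ring.
    rewrite ler_pdivrMr//.
    apply: (@le_trans _ _ (K2 * Num.sqrt x * (A `^ s * l2 `^ s * x0 * x))); last first.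
      apply: ler_wpM2l as_ge; apply: mulr_ge0; last exact: ltW.
      by rewrite /K2 divr_ge0 ?(ltW D0)// mulr_ge0 ?(ltW hmu)// divr_ge0 ?(ltW c1_gt0) ?(ltW sl2).
    have -> : K2 * Num.sqrt x * (A `^ s * l2 `^ s * x0 * x) =
        x * (c1 / Num.sqrt l2 * Num.sqrt x) * mu.
      rewrite /K2 -[_ / _ * _ * _]mulrA; set D := A `^ s * _ * _.
      have D1 : D != 0 by rewrite gt_eqF.
      by field; rewrite D1 gt_eqF.
    apply: ler_wpM2r; first exact: ltW.
    by apply: ler_wpM2l => //; exact: ltW.
  rewrite [X in _ + X](_ : _ =
      N%:R * eps + p * (N%:R * eps) + x * (a / a `^ s * mu)); last by rewrite /x; ring.
  rewrite bt Ne /norm_const.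
  have : p * Num.sqrt x <= Num.sqrt x by apply: ler_piMl; first exact: ltW.
  have -> : (Num.sqrt (L * W) + (2 + K2) + 1) * Num.sqrt x =
    Num.sqrt (L * W) * Num.sqrt x + 2 * Num.sqrt x + K2 * Num.sqrt x + Num.sqrt x by ring.
  lra.
- have tau2 : tau ^+ 2 = W * l by rewrite sqr_sqrtr// mulr_ge0 ?ltW.
  rewrite q_eq exprM tau2 mulrCA -exprVn -exprMn.
  have e1 : expR 1 != 0 :> R by rewrite gt_eqF// expR_gt0.
  have base : (W * l)^-1 * (walk_const R * M%:R) <= (expR 1)^-1.
    rewrite ler_pdivrMl ?mulr_gt0// /W.
    have -> : expR 1 * walk_const R * C1 * l / expR 1 = walk_const R * (C1 * l) by field.
    by apply: ler_wpM2l M2; exact/ltW/walk_const_gt0.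
  have pw : ((W * l)^-1 * (walk_const R * M%:R)) ^+ M <= N%:R `^ (- (Q + 1)).
    apply: (@le_trans _ _ ((expR 1)^-1 ^+ M)).
      apply: lerXn2r base; rewrite nnegrE ?invr_ge0 ?expR_ge0//.
      have Wl0 : 0 <= W * l := mulr_ge0 (ltW W_gt0) (ltW l0).
      have wM0 : 0 <= walk_const R * M%:R := mulr_ge0 (ltW (walk_const_gt0 R)) (ltW Mpos).
      by rewrite mulr_ge0// invr_ge0.
    rewrite exprVn -expRM_natr mul1r -expRN /powR gt_eqF//.
    by rewrite ler_expR mulNr lerN2.
  apply: le_trans (ler_wpM2l _ pw) _.
    rewrite invr_ge0; apply: mulr_ge0; apply: divr_ge0 => //; exact: ltW.
  have -> : N%:R `^ (- (Q + 1)) = N%:R `^ (- Q) / N%:R.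
    by rewrite opprD powRD ?lt0r_neq0 ?implybT// powR_inv1// ltW.
  have -> : (4 / L * (l / N%:R))^-1 * (N%:R `^ (- Q) / N%:R) = L / (4 * l) * N%:R `^ (- Q).
    by field; rewrite !gt_eqF.
  apply: ler_wpM2r; first exact: powR_ge0.
  apply: ler_wpM2l; first exact: ltW.
  by rewrite lef_pV2 ?posrE ?mulr_gt0// ler_wpM2l.
Qed.

End Constants.

Theorem theorem1p1 (R : realType) (delta mu B Q A : R)
  (hdelta : 0 < delta) (hmu : 0 < mu) (hB : 0 < B) (hQ : 1 <= Q) (hA : 0 < A) :
  exists K C : R,
  forall (n : nat -> nat) (y0 : R),
    0 < y0 -> y0 < 1 ->
    (fun N : nat => (n N)%:R / N%:R : R) @ \oo --> y0 ->
  forall N : nat, (1 <= n N)%N -> (n N < N)%N ->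
  forall (p : R) (d : measure_display) (T : measurableType d)
    (P : probability T R) (X xi : 'I_N -> 'I_(n N) -> {RV P >-> R}),
    sparse_model X xi p ->
    (forall j k, ('E_P[(fun w => `|X j k w| `^ (4 + delta))%R] <= mu%:E)%E) ->
    B * (ln (N%:R : R)) `^ (3 / (2 * varkappa delta)) <= N%:R * p ->
  forall (j1 : 'I_N) (k1 : 'I_(n N)), j1 = 0%N :> nat -> k1 = 0%N :> nat ->
    (P [set w | (K * Num.sqrt (N%:R * p) <=
                 largest_singular_value (sparse_matrix X xi w))%R]
     <= (C * N%:R `^ (- Q))%:E
        + (N%:R ^+ 2 * p)%:E *
          P [set w | (A * (N%:R * p) `^ (1 / 2 - varkappa delta) * ln (N%:R : R)
                      < `|X j1 k1 w|)%R])%E.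
Proof.
exists (norm_const delta mu B Q A), (tail_const delta B A).
move=> n y0 _ _ _ N n1 nN p d T P X xi model Xs lx j1 k1 _ _.
have N2 : (2 <= N)%N := leq_ltn_trans n1 nN.
have /andP[_ p1] := bernoulli_range model j1 k1.
have [p0 a0 [b [tau [eps [i [[ab q1 qM tau0] [eps0 eps1 tE pE]]]]]]] :=
  parameters_exist hdelta hmu hB hQ hA N2 p1 lx.
set x := N%:R * p in tE a0 ab *.
set a := truncation_level delta A x (ln N%:R) in tE a0 ab.
have k0 : 0 <= a / a `^ (4 + delta) by rewrite divr_ge0 ?powR_ge0// ltW.
have large (y : R) : a < `|y| -> `|y| <= a / a `^ (4 + delta) * `|y| `^ (4 + delta).
  exact: large_le_moment.
apply: le_trans (sparse_tail model a0 eps0 eps1 k0 large Xs j1 k1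
  (ltnW nN) p0 (ltW hmu) ab q1 qM tau0 tE) _.
by apply: leeD => //; rewrite lee_fin.
Qed.
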